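(* Let $X$ be a Banach space such that $c_0\not\subset X^*$ (i.e. $X^*$ contains no closed subspace isomorphic to $c_0$), and let $f\in L^\infty_{w^*}(\mathbb{R},X^* )$ be such that $R(\lambda,B^* )f\in AP(\mathbb{R},X^* )$ for all $\lambda>0$. If for every $\lambda>0$ the integrals $$\int_0^t \big(R(\lambda,B^* )f\big)(s)\,ds,\qquad t\in\mathbb{R},$$ are bounded in $X^*$ (as $t$ ranges over $\mathbb{R}$), then the function $$t\mapsto w^*\text{-}\int_0^t f(s)\,ds$$ belongs to $AP(\mathbb{R},X^* )$.
   Context: $L^\infty_{w^*}(\mathbb{R},X^* )$ is the space of (classes of) functions $g:\mathbb{R}\to X^*$ that are $w^*$-measurable (i.e. $r\mapsto\langle g(r),x\rangle$ is Lebesgue measurable for all $x\in X$) with $\|g(\cdot)\|\in L^\infty(\mathbb{R})$, two functions $g_1,g_2$ being identified when for each $x\in X$ one has $\langle g_1(\cdot),x\rangle=\langle g_2(\cdot),x\rangle$ a.e.; it is identified with $L^1(\mathbb{R},X)^*$ via $\langle g,f\rangle=\int_{\mathbb{R}}\langle g(r),f(r)\rangle\,dr$. $\{V(t)\}_{t\in\mathbb{R}}$ is the translation $C_0$-group $(V(t)f)(s)=f(s-t)$ on $L^1(\mathbb{R},X)$, $B$ is its generator, $B^*$ is the adjoint of $B$, and $R(\lambda,B)=(\lambda-B)^{-1}$, $R(\lambda,B^* )=(\lambda-B^* )^{-1}=R(\lambda,B)^*$, acting on $L^\infty_{w^*}(\mathbb{R},X^* )$. The dual operators are $(V^*(t)g)(s)=g(t+s)$.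 Elements $R(\lambda,B^* )f$ lie in (are represented by functions in) $BUC(\mathbb{R},X^* )$, the space of bounded uniformly continuous functions, and are evaluated pointwise using that representative. $AP(\mathbb{R},X^* )$ is the space of (Bohr) almost periodic functions $\mathbb{R}\to X^*$, and an element of $L^\infty_{w^*}(\mathbb{R},X^* )$ is said to lie in it if it has a representative in it. The weak$^*$ integral $w^*\text{-}\int_0^t f(s)\,ds\in X^*$ is defined by $\langle x,w^*\text{-}\int_0^t f(s)\,ds\rangle=\int_0^t\langle x,f(s)\rangle\,ds$ for $x\in X$. *)

(* Defs.v *)
From HB Require Import structures.
From mathcomp Require Import all_boot all_order all_algebra.
From mathcomp Require Import complex.
From mathcomp Require Import all_classical all_reals all_analysis.

Set Implicit Arguments.
Unset Strict Implicit.
Unset Printing Implicit Defensive.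

Import Order.TTheory GRing.Theory Num.Theory.
Import numFieldNormedType.Exports.

Local Open Scope classical_set_scope.
Local Open Scope ring_scope.

(* Banach spaces are taken over either scalar field: everything below is
   parameterized by [s], and [scalarField R s] is R or R[i]. *)
Variant scalar_kind := RealScalars | ComplexScalars.

Definition scalarField (R : realType) (s : scalar_kind) : numFieldType :=
  match s return numFieldType with
  | RealScalars => R
  | ComplexScalars => R[i]
  end.

Section Scalars.
Context {R : realType} {s : scalar_kind}.
Notation K := (scalarField R s).

Definition sRe : K -> R :=
  match s return scalarField R s -> R with
  | RealScalars => id
  | ComplexScalars => @complex.Re R
  end.

Definition sIm : K -> R :=
  match s return scalarField R s -> R with
  | RealScalars => fun=> 0
  | ComplexScalars => @complex.Im R
  end.

Definition mkscalar : R -> R -> K :=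
  match s return R -> R -> scalarField R s with
  | RealScalars => fun x _ => x
  | ComplexScalars => fun x y => Complex x y
  end.

Definition ofR (x : R) : K := mkscalar x 0.

(* The norm of a normed module over K takes its values in K; [rnorm] is the
   same norm with values in R. *)
Definition rnorm (Y : normedModType K) (y : Y) : R := sRe `|y|.

End Scalars.

Section ScalarLemmas.
Context {R : realType} {s : scalar_kind}.
Notation K := (scalarField R s).
Implicit Types (x y : R) (k : K).

Lemma ofRD x y : ofR (x + y) = ofR x + ofR y :> K.
Proof. by rewrite /ofR; case: s => //=; simpc. Qed.

Lemma ofRM x y : ofR (x * y) = ofR x * ofR y :> K.
Proof. by rewrite /ofR; case: s => //=; simpc. Qed.

Lemma ofR0 : ofR 0 = 0 :> K.
Proof. by rewrite /ofR; case: s. Qed.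

Lemma ofR1 : ofR 1 = 1 :> K.
Proof. by rewrite /ofR; case: s. Qed.

Lemma ofR_le x y : (ofR x <= ofR y :> K) = (x <= y).
Proof. by rewrite /ofR; case: s => //=; rewrite lecR. Qed.

Lemma sRe_ofR x : sRe (ofR x : K) = x.
Proof. by rewrite /ofR /sRe; case: s. Qed.

Lemma sRe0 : sRe (0 : K) = 0.
Proof. by rewrite -ofR0 sRe_ofR. Qed.

Lemma sRe_le k l : k <= l -> sRe k <= sRe l.
Proof.
rewrite /sRe; move: k l; rewrite /scalarField; case: s => //= -[a b] [c d].
by rewrite lecE => /andP[].
Qed.

Lemma sReD k l : sRe (k + l) = sRe k + sRe l.
Proof.
by rewrite /sRe; move: k l; rewrite /scalarField; case: s => //= -[a b] [c d].
Qed.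

Lemma ofR_sRe k : 0 <= k -> ofR (sRe k) = k.
Proof.
rewrite /ofR /sRe; move: k; rewrite /scalarField; case: s => //= -[a b].
by rewrite lecE /= => /andP[/eqP -> _].
Qed.

Lemma ofR_rnorm (Y : normedModType K) (u : Y) : ofR (rnorm u) = `|u|.
Proof. exact/ofR_sRe/normr_ge0. Qed.

Variable Y : normedModType K.
Implicit Types u v : Y.

Lemma rnorm_ge0 u : 0 <= rnorm u.
Proof. by rewrite -sRe0; exact/sRe_le/normr_ge0. Qed.

Lemma rnormD u v : rnorm (u + v) <= rnorm u + rnorm v.
Proof. by rewrite -sReD; exact/sRe_le/ler_normD. Qed.

Lemma rnormZ k u : rnorm (k *: u) = rnorm (k : K^o) * rnorm u.
Proof.
rewrite -[LHS]sRe_ofR -[RHS]sRe_ofR ofRM.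
by rewrite !ofR_rnorm normrZ.
Qed.

Lemma rnorm0_eq0 u : rnorm u = 0 -> u = 0.
Proof. by move=> u0; apply/normr0_eq0; rewrite -ofR_rnorm u0 ofR0. Qed.

Lemma rnorm0 : rnorm (0 : Y) = 0.
Proof. by rewrite /rnorm normr0 sRe0. Qed.

Lemma rnorm_le u (M : R) : (rnorm u <= M) = (`|u| <= ofR M).
Proof. by rewrite -ofR_rnorm ofR_le. Qed.

End ScalarLemmas.

Section Dual.
Context {R : realType} {s : scalar_kind}.
Notation K := (scalarField R s).
Variable X : normedModType K.

Definition is_functional : {pred X -> K^o} :=
  fun phi => `[< linear phi /\ continuous phi >].

Fact is_functional_submod : submod_closed is_functional.
Proof.
split.
  apply/asboolP; split; first by move=> a x y /=; rewrite scaler0 addr0.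
  exact: cst_continuous.
move=> a phi psi /asboolP[lphi cphi] /asboolP[lpsi cpsi]; apply/asboolP; split.
  move=> b x y; rewrite !fctE lphi lpsi.
  by rewrite !scalerDr !scalerA (mulrC a b) addrACA.
by move=> x; apply: cvgD; [apply: cvgZr; exact: cphi | exact: cpsi].
Qed.

HB.instance Definition _ :=
  GRing.isSubmodClosed.Build K (X -> K^o) is_functional is_functional_submod.

Definition dual := {phi : X -> K^o | phi \in is_functional}.

HB.instance Definition _ := SubChoice.on dual.
HB.instance Definition _ := [SubChoice_isSubLmodule of dual by <:].

Definition dual_fun (phi : dual) : X -> K^o := val phi.

Fact dual_fun_is_linear (phi : dual) : linear (dual_fun phi).
Proof. by have /asboolP[] := valP phi. Qed.

HB.instance Definition _ (phi : dual) :=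
  GRing.isLinear.Build K X K^o *:%R (dual_fun phi) (dual_fun_is_linear phi).

Lemma dual_fun_continuous (phi : dual) : continuous (dual_fun phi).
Proof. by have /asboolP[] := valP phi. Qed.

Definition dual_norm (phi : dual) : R :=
  sup [set rnorm (dual_fun phi x) | x in [set x | rnorm x <= 1]].

Let dual_bounded (phi : dual) :
  exists M : R, forall x, rnorm (dual_fun phi x) <= M * rnorm x.
Proof.
have /linear_bounded_continuous/linear_boundedP := @dual_fun_continuous phi.
move=> /pinfty_ex_gt0[M M0 phiM]; exists (sRe M) => x.
rewrite rnorm_le ofRM ofR_rnorm (ofR_sRe (ltW M0)); exact: phiM.
Qed.

Let dual_norm_has_sup (phi : dual) :
  has_sup [set rnorm (dual_fun phi x) | x in [set x | rnorm x <= 1]].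
Proof.
split; first by exists (rnorm (dual_fun phi 0)), 0 => //=; rewrite rnorm0.
have [M phiM] := dual_bounded phi.
exists `|M| => _ [x /= x1 <-]; rewrite (le_trans (phiM x))//.
rewrite (le_trans (ler_wpM2r (rnorm_ge0 x) (ler_norm M)))//.
by rewrite ler_piMr.
Qed.

Lemma dual_norm_ge0 (phi : dual) : 0 <= dual_norm phi.
Proof.
apply: le_trans (rnorm_ge0 (dual_fun phi 0)) _.
by apply: sup_upper_bound => //; exists 0 => //=; rewrite rnorm0.
Qed.

Lemma dual_norm_ub (phi : dual) x :
  rnorm (dual_fun phi x) <= dual_norm phi * rnorm x.
Proof.
have [->|x0] := eqVneq x 0; first by rewrite linear0 !rnorm0 mulr0.
have nx0 : 0 < rnorm x.
  by rewrite lt_def rnorm_ge0 andbT; apply: contra_neq x0; exact: rnorm0_eq0.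
have nV : rnorm (ofR (rnorm x)^-1 : K^o) = (rnorm x)^-1.
  by rewrite /rnorm /= ger0_norm ?sRe_ofR// -ofR0 ofR_le invr_ge0 ltW.
rewrite -ler_pdivrMr// mulrC -nV -rnormZ -linearZ.
apply: sup_upper_bound => //; exists (ofR (rnorm x)^-1 *: x) => //=.
by rewrite rnormZ nV mulVf ?gt_eqF.
Qed.

Let dual_norm_le (phi : dual) (M : R) :
  (forall x, rnorm x <= 1 -> rnorm (dual_fun phi x) <= M) -> dual_norm phi <= M.
Proof.
move=> phiM; apply: ge_sup; first by case: (dual_norm_has_sup phi).
by move=> _ [x /= x1 <-]; exact: phiM.
Qed.

Let normK (phi : dual) : K := ofR (dual_norm phi).

Let dual_normD phi psi : normK (phi + psi) <= normK phi + normK psi.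
Proof.
rewrite -ofRD ofR_le; apply: dual_norm_le => x x1.
rewrite (le_trans (rnormD _ _))// lerD// (le_trans (dual_norm_ub _ _))//.
  by rewrite ler_piMr ?dual_norm_ge0.
by rewrite ler_piMr ?dual_norm_ge0.
Qed.

Let dual_normZ_le k phi :
  dual_norm (k *: phi) <= rnorm (k : K^o) * dual_norm phi.
Proof.
apply: dual_norm_le => x x1; rewrite [X in rnorm X]/(k *: (dual_fun phi x)).
rewrite rnormZ ler_wpM2l ?rnorm_ge0// (le_trans (dual_norm_ub _ _))//.
by rewrite ler_piMr ?dual_norm_ge0.
Qed.

Let dual_normZ k phi : normK (k *: phi) = `|k| * normK phi.
Proof.
rewrite -[`|k|](ofR_rnorm (k : K^o)) -ofRM; congr ofR.
apply/eqP; rewrite eq_le dual_normZ_le /=.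
have [->|k0] := eqVneq k 0; first by rewrite rnorm0 mul0r dual_norm_ge0.
have nk0 : 0 < rnorm (k : K^o).
  rewrite lt_def rnorm_ge0 andbT; apply: contra_neq k0; exact: rnorm0_eq0.
rewrite -ler_pdivlMl// -[phi in leLHS]scale1r -(mulVf k0) -scalerA.
rewrite (le_trans (dual_normZ_le _ _))// ler_wpM2r ?dual_norm_ge0//.
rewrite -(ler_pM2r nk0) mulVf ?gt_eqF// -rnormZ /= /GRing.scale/= mulVf//.
by rewrite /rnorm normr1 -ofR1 sRe_ofR.
Qed.

Let dual_norm0_eq0 phi : normK phi = 0 -> phi = 0.
Proof.
move=> /(congr1 sRe); rewrite sRe_ofR sRe0 => phi0.
apply/val_inj/funext => x; apply: rnorm0_eq0; apply/eqP.
by rewrite eq_le rnorm_ge0 andbT (le_trans (dual_norm_ub _ _))// phi0 mul0r.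
Qed.

HB.instance Definition _ := Lmodule_isNormed.Build K dual
  dual_normD dual_normZ dual_norm0_eq0.

Lemma rnorm_dualE (phi : dual) : rnorm phi = dual_norm phi.
Proof. exact: sRe_ofR. Qed.

End Dual.
Coercion dual_fun : dual >-> Funclass.

Section LebesgueScalar.
Context {R : realType} {s : scalar_kind}.
Notation K := (scalarField R s).

(* Lebesgue (not just Borel) measurability of functions on the real line:
   [lebR] is R with the sigma-algebra of Lebesgue measurable sets. *)
Definition lebR : measurableType _ :=
  caratheodory_type ((wlength (@idfun R))^*)%mu.

Definition leb : {measure set lebR -> \bar R} := @completed_lebesgue_measure R.

Definition smeasurable (g : R -> K) : Prop :=
  measurable_fun [set: lebR] (sRe \o g : lebR -> R) /\
  measurable_fun [set: lebR] (sIm \o g : lebR -> R).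

Definition sintegral (D : set R) (g : R -> K) : K :=
  mkscalar (\int[leb]_(r in D) sRe (g r)) (\int[leb]_(r in D) sIm (g r)).

Definition sprimitive (g : R -> K) (t : R) : K :=
  if 0 <= t then sintegral `[0, t] g else - sintegral `[t, 0] g.

End LebesgueScalar.
Arguments lebR : clear implicits.
Arguments leb : clear implicits.

Section Bochner.
Context {R : realType} {s : scalar_kind}.
Notation K := (scalarField R s).
Variable Y : normedModType K.

(* [:: (A_1, y_1); ...; (A_n, y_n)] encodes the simple function
   \sum_i 1_(A_i) y_i; the A_i need not be disjoint. *)
Definition simple_code : Type := seq (set R * Y).

Definition simple_ok (c : simple_code) : Prop :=
  forall i, (i < size c)%N ->
    let A : set (lebR R) := (nth (set0, 0) c i).1 in
    measurable A /\ (leb R A < +oo)%E.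

Definition simple_eval (c : simple_code) (r : R) : Y :=
  \sum_(p <- c) (if r \in p.1 then p.2 else 0).

Definition simple_integral (D : set R) (c : simple_code) : Y :=
  \sum_(p <- c) (ofR (fine (leb R (p.1 `&` D))) : K) *: p.2.

Definition simple_approx (D : set R) (f : R -> Y) (c : nat -> simple_code) :=
  (forall n, simple_ok (c n)) /\
  {ae leb R, forall r : lebR R, D r ->
     (fun n => simple_eval (c n) r) @ \oo --> f r}.

Definition strongly_measurable (f : R -> Y) : Prop :=
  exists c, simple_approx setT f c.

Definition L1norm (f : R -> Y) : \bar R :=
  (\int[leb R]_r (rnorm (f r))%:E)%E.

Definition L1 (f : R -> Y) : Prop :=
  strongly_measurable f /\ (L1norm f < +oo)%E.

(* I is the Bochner integral of f over D. *)
Definition is_bochner_integral (D : set R) (f : R -> Y) (I : Y) : Prop :=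
  exists c : nat -> simple_code,
    [/\ simple_approx D f c,
        (fun n => \int[leb R]_(r in D)
           (rnorm (f r - simple_eval (c n) r))%:E)%E @ \oo --> 0%E
      & (fun n => simple_integral D (c n)) @ \oo --> I].

(* I is the integral of f from 0 to t, where t may be negative. *)
Definition is_bochner_primitive_at (f : R -> Y) (t : R) (I : Y) : Prop :=
  if 0 <= t then is_bochner_integral `[0, t] f I
  else is_bochner_integral `[t, 0] f (- I).

(* Bohr almost periodicity: the eps-almost periods are relatively dense. *)
Definition almost_periodic (h : R -> Y) : Prop :=
  continuous h /\
  forall eps : R, 0 < eps ->
    exists2 L : R, 0 < L &
      forall a : R, exists2 tau : R, a <= tau <= a + L &
        forall r, rnorm (h (r + tau) - h r) <= eps.

Definition c0 : set (nat -> K^o) := [set u | u @ \oo --> (0 : K^o)].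

Definition c0_norm (u : nat -> K^o) : R := sup (range (fun n => rnorm (u n))).

(* T is an isomorphism of c0 (over K) onto a closed subspace of Y; its values
   outside c0 are irrelevant. *)
Definition contains_c0 : Prop :=
  exists T : (nat -> K^o) -> Y,
    [/\ forall (a : K) u v, c0 u -> c0 v -> T (a *: u + v) = a *: T u + T v,
        exists M : R, forall u, c0 u -> rnorm (T u) <= M * c0_norm u,
        exists2 m : R, 0 < m & forall u, c0 u -> m * c0_norm u <= rnorm (T u)
      & closed (T @` c0)].

End Bochner.

Section TranslationGroup.
Context {R : realType} {s : scalar_kind}.
Notation K := (scalarField R s).
Variable X : normedModType K.

Definition translation (t : R) (phi : R -> X) : R -> X := fun r => phi (r - t).

(* phi is in the domain of the generator B of the translation group on
   L^1(R, X), and B phi = psi. *)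
Definition is_generator (phi psi : R -> X) : Prop :=
  [/\ L1 phi, L1 psi
    & (fun t : R => L1norm (fun r =>
         (ofR t^-1 : K) *: (translation t phi r - phi r) - psi r))
      @ 0^' --> 0%E].

Definition Linf_wstar (g : R -> dual X) : Prop :=
  (forall x, smeasurable (fun r => g r x)) /\
  ((fun r => rnorm (g r)) : lebR R -> R) \in Lfun (leb R) +oo%E.

Definition pairing (g : R -> dual X) (phi : R -> X) : K :=
  sintegral setT (fun r => g r (phi r)).

(* g is in the domain of the adjoint B^*, and B^* g = k. *)
Definition is_adjoint_generator (g k : R -> dual X) : Prop :=
  [/\ Linf_wstar g, Linf_wstar k
    & forall phi psi, is_generator phi psi -> pairing g psi = pairing k phi].

(* Equality in L^oo_{w*}: the exceptional null set may depend on x. *)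
Definition wstar_ae_eq (g1 g2 : R -> dual X) : Prop :=
  forall x, {ae leb R, forall r : lebR R, g1 r x = g2 r x}.

(* h represents R(lambda, B^* ) f, i.e. (lambda - B^* ) h = f in L^oo_{w*};
   k represents B^* h.  The pointwise difference lambda h - f need not itself
   satisfy [Linf_wstar], as its norm may fail to be measurable. *)
Definition is_adjoint_resolvent (lambda : R) (f h : R -> dual X) : Prop :=
  exists2 k, is_adjoint_generator h k
    & wstar_ae_eq (fun r => (ofR lambda : K) *: h r - k r) f.

(* F is t |-> w*-int_0^t f(s) ds. *)
Definition is_wstar_primitive (f F : R -> dual X) : Prop :=
  forall t x, F t x = sprimitive (fun r => f r x) t.

End TranslationGroup.

(* Main.v *)
Require Import Defs.
From HB Require Import structures.
From mathcomp Require Import all_boot all_order all_algebra.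
From mathcomp Require Import complex.
From mathcomp Require Import all_classical all_reals all_analysis.
From mathcomp Require Import measurable_realfun ess_sup_inf ring lra.

(** Let h = R(1, B^* ) f.  Since B^* acts as differentiation, the relation
    (1 - B^* ) h = f says that <f, x> = <h, x> - <h, x>' weakly for every x, and
    integrating from 0 to t gives

      w*-int_0^t f = H(t) - h(t) + h(0),   where H(t) = int_0^t h.

    Since h is almost periodic, the claim follows once the sufficiently good almost
    periods of h are also almost periods of H.  This is Kadets' theorem: in a space
    which does not contain c0, a bounded primitive of an almost periodic function is
    almost periodic.

    The weak derivative is obtained by testing the adjoint relation against
    trapezoids times a vector x.  These lie in the domain of the generator, since
    the difference quotient of a trapezoid is exact away from its four corners
    ([trapezoid_generator]), and they approximate indicators of intervals
    ([weak_derivative], [resolvent_primitive]).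

    For Kadets' theorem ([kadets]), an almost period of h changes the increments of H
    over bounded intervals only slightly.  If some very good almost periods tau moved
    H(0) by a distance at least delta, one could choose a sequence tau_n of them,
    each much better than the previous ones are long.  All finite sums of the vectors
    y_n = H(tau_n) - H(0) would then be almost of the form H(t) - H(0), so they would
    be bounded; as |y_n| >= delta, this yields a copy of c0 in the dual
    ([bessaga_pelczynski]).  In a dual space the copy of c0 can be obtained without
    basic sequences: Rosenthal's lemma, applied to the matrix of the values of the
    y_m at almost norming vectors, selects a subsequence which is almost
    biorthogonal to these vectors ([rosenthal]). *)

Set Implicit Arguments.
Unset Strict Implicit.
Unset Printing Implicit Defensive.

Import Order.TTheory GRing.Theory Num.Theory.
Import numFieldNormedType.Exports.

Local Open Scope classical_set_scope.
Local Open Scope ring_scope.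

(** * Real and imaginary parts, and real-valued norms *)

Section ScalarComponents.
Context {R : realType} {s : scalar_kind}.
Notation K := (scalarField R s).
Implicit Types (k l : K) (a : R) (c : bool).

(** Handles real and imaginary parts uniformly, so that each integral identity
    below is proved once, for a real integrand. *)
Definition part c : K -> R := if c then sRe else sIm.

Lemma partD c k l : part c (k + l) = part c k + part c l.
Proof.
case: c; first exact: sReD.
move: k l; rewrite /part /sIm /scalarField; case: s => /=.
  by move=> *; rewrite addr0.
by move=> [? ?] [? ?].
Qed.

Lemma part_ofRM c a k : part c (ofR a * k) = a * part c k.
Proof.
move: k; rewrite /part /sRe /sIm /ofR /mkscalar /scalarField; case: s => /= k.
  by case: c => //; rewrite mulr0.
by case: c; case: k => u v /=; rewrite mul0r ?subr0 ?addr0.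
Qed.

Lemma part0 c : part c 0 = 0.
Proof. by rewrite -(mul0r 0) -[X in X * 0]ofR0 part_ofRM mul0r. Qed.

Lemma ofRN a : ofR (- a) = - ofR a :> K.
Proof. by apply/eqP; rewrite -addr_eq0 -ofRD addNr ofR0. Qed.

Lemma partN c k : part c (- k) = - part c k.
Proof. by apply/eqP; rewrite -addr_eq0 -partD addNr part0. Qed.

Lemma partB c k l : part c (k - l) = part c k - part c l.
Proof. by rewrite partD partN. Qed.

Lemma part_sum c I (r : seq I) (F : I -> K) :
  part c (\sum_(i <- r) F i) = \sum_(i <- r) part c (F i).
Proof. exact: (big_morph _ (partD c) (part0 c)). Qed.

Lemma part_eq k l : (forall c, part c k = part c l) -> k = l.
Proof.
move=> kl; move: (kl true) (kl false); clear kl; move: k l.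
rewrite /part /sRe /sIm /scalarField; case: s => //= -[? ?] [? ?] /= -> ->//.
Qed.

Lemma part_mkscalar c (x y : R) : part c (mkscalar x y : K) =
  if c then x else if s is ComplexScalars then y else 0.
Proof. by rewrite /part /sRe /sIm /mkscalar /scalarField; case: s; case: c. Qed.

Lemma rnorm_scalarE k : rnorm (k : K^o) = sRe `|k|.
Proof. by []. Qed.

Lemma rnorm_ofR a : rnorm (ofR a : K^o) = `|a|.
Proof.
rewrite rnorm_scalarE /sRe /ofR /mkscalar /scalarField; case: s => //=.
by rewrite expr0n addr0 sqrtr_sqr.
Qed.

Lemma norm_part c k : `|part c k| <= rnorm (k : K^o).
Proof.
rewrite rnorm_scalarE; move: k; rewrite /part /sRe /sIm /scalarField; case: s => /= k.
  by case: c; rewrite ?normr0.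
case: k => u v /=; case: c.
  by rewrite -sqrtr_sqr ler_wsqrtr// lerDl sqr_ge0.
by rewrite -sqrtr_sqr ler_wsqrtr// lerDr sqr_ge0.
Qed.

(** Bounding the two parts separately costs at most a factor 2 in the norm,
    which the estimates below can afford. *)
Lemma rnorm_le_part k : rnorm (k : K^o) <= `|part true k| + `|part false k|.
Proof.
rewrite rnorm_scalarE; move: k; rewrite /part /sRe /sIm /scalarField; case: s => /= k.
  by rewrite normr0 addr0.
case: k => u v /=.
rewrite -[leRHS]ger0_norm ?addr_ge0// -sqrtr_sqr ler_wsqrtr//.
by rewrite sqrrD !real_normK ?num_real// addrAC lerDl mulrn_wge0// mulr_ge0.
Qed.

Variable Y : normedModType K.
Implicit Types y z : Y.

Lemma rnormZ_ofR a y : rnorm (ofR a *: y : Y) = `|a| * rnorm y.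
Proof. by rewrite rnormZ rnorm_ofR. Qed.

Lemma rnormN y : rnorm (- y) = rnorm y.
Proof. by rewrite /rnorm normrN. Qed.

Lemma rnorm_distC y z : rnorm (y - z) = rnorm (z - y).
Proof. by rewrite -rnormN opprB. Qed.

Lemma rnorm_sum I (r : seq I) (F : I -> Y) :
  rnorm (\sum_(i <- r) F i) <= \sum_(i <- r) rnorm (F i).
Proof.
elim/big_rec2: _ => [|i a y _ le_ya]; first by rewrite rnorm0.
by rewrite (le_trans (rnormD _ _))// lerD2l.
Qed.

Lemma rnorm_triangle x y z : rnorm (x - z : Y) <= rnorm (x - y) + rnorm (y - z).
Proof. by rewrite -[x in leLHS](subrK y) -addrA rnormD. Qed.

Lemma rnorm_dist y z : `|rnorm y - rnorm z| <= rnorm (y - z).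
Proof.
have := rnormD (y - z) z; rewrite subrK => yz.
have := rnormD (z - y) y; rewrite subrK rnorm_distC => zy.
by rewrite ler_norml; apply/andP; split; lra.
Qed.

(** The topology of a normed module over K is defined by its K-valued norm;
    this translates convergence into the real-valued norm. *)
Lemma rcvgP {T} {F : set_system T} {FF : Filter F} (u : T -> Y) y :
  u @ F --> y <->
  forall e : R, 0 < e -> \forall t \near F, rnorm (y - u t) <= e.
Proof.
split=> [/cvgrPdist_le uy e e0|uy].
  have eK : 0 < ofR e :> K.
    rewrite lt_def -{2}ofR0 ofR_le ltW// andbT.
    apply/eqP => /(congr1 sRe); rewrite sRe_ofR sRe0 => e00.
    by move: e0; rewrite e00 ltxx.
  by move: (uy _ eK); apply: filterS => t; rewrite rnorm_le.
apply/cvgrPdist_le => e e0.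
have eE := ofR_sRe (ltW e0).
have e0' : 0 < sRe e.
  rewrite lt_def -{2}(@sRe0 R s) sRe_le ?ltW// andbT; apply: contraTneq e0 => e00.
  by rewrite -eE e00 ofR0 ltxx.
by move: (uy _ e0'); apply: filterS => t; rewrite rnorm_le eE.
Qed.

Lemma rcvg_cauchy (y : nat -> Y) z (e : R) : y @ \oo --> z -> 0 < e ->
  exists N, forall n, (N <= n)%N -> rnorm (z - y n) <= e.
Proof. by move=> /rcvgP/[apply] -[N _ yN]; exists N => n Nn; exact: yN. Qed.

End ScalarComponents.

Section DualNorm.
Context {R : realType} {s : scalar_kind}.
Notation K := (scalarField R s).
Variable X : normedModType K.
Implicit Types (y z : dual X) (x : X).

Lemma dualD y z x : dual_fun (y + z) x = y x + z x. Proof. by []. Qed.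

Lemma dualN y x : dual_fun (- y) x = - y x. Proof. by []. Qed.

Lemma dualB y z x : dual_fun (y - z) x = y x - z x. Proof. by []. Qed.

Lemma dualZ (k : K) y x : dual_fun (k *: y) x = k * y x. Proof. by []. Qed.

Lemma dual_sum I (r : seq I) (F : I -> dual X) x :
  dual_fun (\sum_(i <- r) F i) x = \sum_(i <- r) F i x.
Proof. exact: (big_morph (fun y : dual X => dual_fun y x)). Qed.

Lemma rnorm_dual_apply y x : rnorm (y x) <= rnorm y * rnorm x.
Proof. by rewrite rnorm_dualE; exact: dual_norm_ub. Qed.

Lemma rnorm_dual_le y (M : R) :
  (forall x, rnorm x <= 1 -> rnorm (y x) <= M) -> rnorm y <= M.
Proof.
move=> yM; rewrite rnorm_dualE; apply: ge_sup.
  by exists (rnorm (y 0)), 0 => //=; rewrite rnorm0.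
by move=> _ [x /= x1 <-]; exact: yM.
Qed.

Lemma rnorm_dual_lt y (m : R) : m < rnorm y ->
  exists2 x, rnorm x <= 1 & m < rnorm (y x).
Proof.
move=> my; apply: contrapT => nx; move: my; apply/negP; rewrite -leNgt.
apply: rnorm_dual_le => x x1; rewrite leNgt; apply/negP => mx.
by apply: nx; exists x.
Qed.

End DualNorm.

(** * Lebesgue integrals over intervals *)

Section LebesgueLine.
Context {R : realType}.
Implicit Types (g u v w : R -> R) (a b : R).

Lemma leb_measurable (A : set R) :
  measurable (A : set (measurableTypeR R)) -> measurable (A : set (lebR R)).
Proof. by move=> mA; exact: sub_caratheodory. Qed.

Lemma leb_measurable_fun g :
  measurable_fun [set: measurableTypeR R] (g : measurableTypeR R -> R) ->
  measurable_fun [set: lebR R] (g : lebR R -> R).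
Proof. by move=> mg _ Y mY; apply: leb_measurable; exact: mg. Qed.

Lemma leb_itv (i : interval R) : measurable ([set` i] : set (lebR R)).
Proof. by apply: leb_measurable; exact: measurable_itv. Qed.

Lemma leb_oc a b : a <= b -> leb R (`]a, b]%classic : set (lebR R)) = (b - a)%:E.
Proof.
move=> ab; have := @lebesgue_measure_itv R `]a, b].
rewrite /= lte_fin; move: ab; rewrite le_eqVlt => /predU1P[->|->].
  by rewrite ltxx subrr.
by rewrite -EFinD.
Qed.

Lemma leb_cc a b : a <= b -> leb R (`[a, b]%classic : set (lebR R)) = (b - a)%:E.
Proof.
move=> ab; have := @lebesgue_measure_itv R `[a, b].
rewrite /= lte_fin; move: ab; rewrite le_eqVlt => /predU1P[->|->].
  by rewrite ltxx subrr.
by rewrite -EFinD.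
Qed.

Lemma continuous_leb_measurable g : continuous g ->
  measurable_fun [set: lebR R] (g : lebR R -> R).
Proof.
by move=> cg; apply: leb_measurable_fun; exact: continuous_measurable_fun.
Qed.

Lemma leb_measurable_cst (c : R) :
  measurable_fun [set: lebR R] ((fun=> c) : lebR R -> R).
Proof. exact: (@measurable_cst _ _ _ _ setT c). Qed.

Lemma leb_measurable_funM u v :
  measurable_fun [set: lebR R] (u : lebR R -> R) ->
  measurable_fun [set: lebR R] (v : lebR R -> R) ->
  measurable_fun [set: lebR R] ((fun r => u r * v r) : lebR R -> R).
Proof. by move=> mu mv; exact: (measurable_funM mu mv). Qed.

Lemma leb_measurable_funD u v :
  measurable_fun [set: lebR R] (u : lebR R -> R) ->
  measurable_fun [set: lebR R] (v : lebR R -> R) ->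
  measurable_fun [set: lebR R] ((fun r => u r + v r) : lebR R -> R).
Proof. by move=> mu mv; exact: (measurable_funD mu mv). Qed.

Lemma leb_measurable_funB u v :
  measurable_fun [set: lebR R] (u : lebR R -> R) ->
  measurable_fun [set: lebR R] (v : lebR R -> R) ->
  measurable_fun [set: lebR R] ((fun r => u r - v r) : lebR R -> R).
Proof. by move=> mu mv; exact: (measurable_funB mu mv). Qed.

Lemma Rintegrable_add (D : set (lebR R)) u v : measurable D ->
    (leb R).-integrable D (EFin \o u) -> (leb R).-integrable D (EFin \o v) ->
  (leb R).-integrable D (EFin \o (fun r => u r + v r)).
Proof.
by move=> mD iu iv; apply: eq_integrable (integrableD mD iu iv) => // r _ /=.
Qed.

Lemma Rintegrable_sub (D : set (lebR R)) u v : measurable D ->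
    (leb R).-integrable D (EFin \o u) -> (leb R).-integrable D (EFin \o v) ->
  (leb R).-integrable D (EFin \o (fun r => u r - v r)).
Proof.
by move=> mD iu iv; apply: eq_integrable (integrableB mD iu iv) => // r _ /=.
Qed.

(** Measurability is required on the whole line, so that a locally integrable
    function can be restricted to any interval or multiplied by an indicator
    without further side conditions. *)
Definition loc_integrable g :=
  measurable_fun [set: lebR R] (g : lebR R -> R) /\
  forall a b, (leb R).-integrable (`[a, b]%classic : set (lebR R)) (EFin \o g).

Lemma bounded_integrable g (D : set (lebR R)) (M : R) :
    measurable D -> (leb R D < +oo)%E ->
    measurable_fun [set: lebR R] (g : lebR R -> R) ->
    (forall r, D r -> `|g r| <= M) ->
  (leb R).-integrable D (EFin \o g).
Proof.
move=> mD Doo mg gM; apply: measurable_bounded_integrable => //.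
  exact: measurable_funTS.
exists M; split; first exact: num_real.
by move=> x Mx r Dr; exact: le_trans (gM r Dr) (ltW Mx).
Qed.

Lemma leb_cc_lty a b : (leb R (`[a, b]%classic : set (lebR R)) < +oo)%E.
Proof.
have [ab|ba] := leP a b; first by rewrite leb_cc// ltry.
by rewrite set_itv_ge ?measure0 ?ltry// bnd_simp -ltNge.
Qed.

Lemma bounded_loc_integrable g (M : R) :
    measurable_fun [set: lebR R] (g : lebR R -> R) ->
    (forall r, `|g r| <= M) -> loc_integrable g.
Proof.
move=> mg gM; split=> // a b; apply: (@bounded_integrable _ _ M) => //.
  exact: leb_itv.
exact: leb_cc_lty.
Qed.

Lemma continuous_loc_integrable g : continuous g -> loc_integrable g.
Proof.
move=> cg; have mg := continuous_leb_measurable cg; split=> // a b.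
have : compact (g @` `[a, b]).
  apply: continuous_compact; last exact: segment_compact.
  exact: continuous_subspaceT.
move=> /compact_bounded[M [_ gM]].
apply: (@bounded_integrable _ _ (M + 1)) => //; [exact: leb_itv|exact: leb_cc_lty|].
by move=> r abr; apply: (gM (M + 1)); [rewrite ltrDl|exists r].
Qed.

Lemma loc_integrable_oc g a b : loc_integrable g ->
  (leb R).-integrable (`]a, b]%classic : set (lebR R)) (EFin \o g).
Proof.
move=> [_ /(_ a b)]; apply: integrableS; try exact: leb_itv.
exact: subset_itv_oc_cc.
Qed.

Lemma Rintegral_cc_oc g a b : loc_integrable g -> a <= b ->
  \int[leb R]_(r in `[a, b]) g r = \int[leb R]_(r in `]a, b]) g r.
Proof.
move=> ig ab; rewrite /Rintegral; congr fine.
rewrite (negligible_integral (N := [set a] : set (lebR R)))//.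
- congr integral; apply/seteqP; split => r /=; rewrite !in_itv/=.
    by move=> [/andP[ar ->] /eqP ra]; rewrite lt_neqAle ar eq_sym ra.
  by move=> /andP[ar ->]; rewrite (ltW ar); split=> //; apply/eqP; rewrite gt_eqF.
- by rewrite -set_itv1; exact: leb_itv.
- exact: leb_itv.
- exact: ig.2.
- by rewrite -set_itv1 leb_cc// subrr.
Qed.

Lemma Rintegral_oc_split g a b c : loc_integrable g -> a <= b -> b <= c ->
  \int[leb R]_(r in `]a, c]) g r =
  \int[leb R]_(r in `]a, b]) g r + \int[leb R]_(r in `]b, c]) g r.
Proof.
move=> ig ab bc; have abc : `]a, b] `|` `]b, c] = `]a, c]%classic.
  by rewrite -itv_bndbnd_setU// bnd_simp.
rewrite -abc Rintegral_setU//; [exact: leb_itv|exact: leb_itv| |].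
  by rewrite abc; exact: loc_integrable_oc.
apply/disj_setPS => r /=; rewrite !in_itv/= => -[/andP[_ rb] /andP[br _]].
by move: br; rewrite ltNge rb.
Qed.

Definition primitive g t : R :=
  if 0 <= t then \int[leb R]_(r in `[0, t]) g r
  else - \int[leb R]_(r in `[t, 0]) g r.

Lemma primitiveB g a b : loc_integrable g -> a <= b ->
  primitive g b - primitive g a = \int[leb R]_(r in `]a, b]) g r.
Proof.
move=> ig ab; rewrite /primitive.
have [b0|b0] := leP 0 b; have [a0|a0] := leP 0 a.
- by rewrite !Rintegral_cc_oc// (Rintegral_oc_split ig a0 ab) addrAC subrr add0r.
- rewrite !Rintegral_cc_oc ?(ltW a0)// opprK addrC.
  by rewrite -Rintegral_oc_split// ltW.
- by move: (le_lt_trans (le_trans a0 ab) b0); rewrite ltxx.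
- rewrite !Rintegral_cc_oc ?ltW// (Rintegral_oc_split ig ab (ltW b0)).
  by rewrite opprK addrC addrK.
Qed.

Lemma norm_Rintegral_oc_le g a b (M : R) : loc_integrable g -> a <= b ->
  (forall r, a < r <= b -> `|g r| <= M) ->
  `|\int[leb R]_(r in `]a, b]) g r| <= M * (b - a).
Proof.
move=> ig ab gM; have iab := loc_integrable_oc a b ig.
apply: le_trans (le_normr_Rintegral _ iab) _; first exact: leb_itv.
rewrite (_ : M * (b - a) = \int[leb R]_(r in `]a, b]) M); last first.
  by rewrite Rintegral_cst ?leb_oc//; exact: leb_itv.
apply: le_Rintegral.
- exact: leb_itv.
- exact: integrable_norm.
- apply: (@bounded_integrable (cst M) _ `|M|) => //; first exact: leb_itv.
  by rewrite leb_oc// ltry.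
- by move=> r /=; rewrite in_itv/=; exact: gM.
Qed.

End LebesgueLine.

(** * Weak derivatives tested against trapezoids *)

Section WeakDerivative.
Context {R : realType}.
Implicit Types (u w : R -> R) (a b c r tau : R).

(** The trapezoid is a difference of two translates of the ramp which climbs
    linearly from 0 to 1 on [0, tau].  Writing the ramp with positive parts makes
    its only non-smooth points, 0 and tau, explicit. *)
Definition ramp tau r : R := (Num.max 0 r - Num.max 0 (r - tau)) / tau.

Definition trapezoid a b tau r : R := ramp tau (r - a) - ramp tau (r - b).

(** The derivative of the trapezoid away from its four corners. *)
Definition slope a b tau r : R :=
  (\1_(`]a, a + tau]%classic : set R) r
   - \1_(`]b, b + tau]%classic : set R) r) / tau.

Lemma indic_oc a b r :
  \1_(`]a, b]%classic : set R) r = ((a < r) && (r <= b))%R%:R :> R.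
Proof.
rewrite indicE; congr (nat_of_bool _)%:R; apply/idP/idP.
  by rewrite inE/= in_itv.
by rewrite inE/= in_itv.
Qed.

Lemma ramp_le0 tau r : 0 < tau -> r <= 0 -> ramp tau r = 0.
Proof.
move=> t0 r0; rewrite /ramp !max_l ?subrr ?mul0r//.
lra.
Qed.

Lemma ramp_ge tau r : 0 < tau -> tau <= r -> ramp tau r = 1.
Proof.
move=> t0 tr; rewrite /ramp !max_r ?subr_ge0//; last lra.
by rewrite opprB addrCA subrr addr0 divff ?gt_eqF.
Qed.

Lemma ramp_itv tau r : 0 < tau -> 0 <= ramp tau r <= 1.
Proof.
move=> t0; rewrite /ramp; apply/andP; split.
  apply: divr_ge0; last exact: ltW.
  by case: (leP 0 r) => ?; case: (leP 0 (r - tau)) => ?; lra.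
rewrite ler_pdivrMr// mul1r.
by case: (leP 0 r) => ?; case: (leP 0 (r - tau)) => ?; lra.
Qed.

Lemma ramp_step tau a r : 0 < tau ->
  `|ramp tau (r - a) - (a < r)%R%:R| <= \1_(`]a, a + tau]%classic : set R) r.
Proof.
move=> t0; rewrite indic_oc; have /andP[r0 r1] := ramp_itv (r - a) t0.
have [ar|ra] := ltP a r => /=; last first.
  by rewrite ramp_le0 ?subr_le0// subr0 normr0.
have [rt|tr] := leP r (a + tau) => /=.
  by rewrite ler_norml; apply/andP; split; lra.
by rewrite ramp_ge ?subrr ?normr0// lerBrDl ltW.
Qed.

Lemma trapezoid_itv a b tau r : a < b -> 0 < tau -> 0 <= trapezoid a b tau r <= 1.
Proof.
move=> ab t0; rewrite /trapezoid.
have /andP[a0 a1] := ramp_itv (r - a) t0.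
have /andP[b0 b1] := ramp_itv (r - b) t0.
apply/andP; split; last lra.
rewrite subr_ge0 /ramp ler_pM2r ?invr_gt0//.
by case: (leP 0 (r - a)) => ?; case: (leP 0 (r - a - tau)) => ?;
   case: (leP 0 (r - b)) => ?; case: (leP 0 (r - b - tau)) => ?; lra.
Qed.

Lemma trapezoid_out a b tau r : a < b -> 0 < tau ->
  ~~ (a < r <= b + tau) -> trapezoid a b tau r = 0.
Proof.
move=> ab t0; rewrite negb_and -leNgt -ltNge /trapezoid => /orP[ra|br].
  by rewrite !ramp_le0 ?subr_le0 ?subrr// (le_trans ra)// ltW.
by rewrite !ramp_ge ?subrr//; lra.
Qed.

Lemma trapezoid_indic a b tau r : a < b -> 0 < tau ->
  `|trapezoid a b tau r - \1_(`]a, b]%classic : set R) r| <=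
  \1_(`]a, a + tau]%classic : set R) r + \1_(`]b, b + tau]%classic : set R) r.
Proof.
move=> ab t0; have -> : \1_(`]a, b]%classic : set R) r = (a < r)%R%:R - (b < r)%R%:R :> R.
  rewrite indic_oc leNgt; have [br|rb] := ltP b r.
    by rewrite (lt_trans ab br) subrr.
  by rewrite subr0 andbT.
have := ler_normB (ramp tau (r - a) - (a < r)%R%:R) (ramp tau (r - b) - (b < r)%R%:R).
rewrite /trapezoid => H; apply: le_trans (lerD (ramp_step a r t0) (ramp_step b r t0)).
apply: le_trans H; rewrite le_eqVlt; apply/orP; left; apply/eqP; congr `|_|; lra.
Qed.

Lemma continuous_trapezoid a b tau : continuous (trapezoid a b tau).
Proof.
have cm (g : R -> R) : continuous g -> continuous (fun r : R => Num.max 0 (g r)).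
  move=> cg r; apply: (@continuous_max R R^o (cst 0) g); last exact: cg.
  exact: cvg_cst.
have cB (g : R -> R) c : continuous g -> continuous (fun r : R => g r - c).
  by move=> cg r; apply: cvgB; [exact: cg|exact: cvg_cst].
have cr c : continuous (fun r => ramp tau (r - c)).
  move=> r; apply: cvgM; last exact: cvg_cst.
  have cid : continuous (id : R -> R) by move=> y; exact: cvg_id.
  apply: cvgB; first exact: (cm _ (cB _ c cid) r).
  exact: (cm _ (cB _ tau (cB _ c cid)) r).
by move=> r; apply: cvgB; exact: cr.
Qed.

Lemma Rintegral_indic_oc u a b : loc_integrable u ->
  (leb R).-integrable setT (EFin \o (fun r => \1_(`]a, b]%classic : set R) r * u r)) /\
  \int[leb R]_r (\1_(`]a, b]%classic : set R) r * u r) = \int[leb R]_(r in `]a, b]) u r.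
Proof.
move=> iu; have -> : (fun r => \1_(`]a, b]%classic : set R) r * u r) = u \_ `]a, b].
  apply/funext => r; rewrite indicE patchE.
  by case: ifP; rewrite ?mul1r ?mul0r.
split; last by rewrite -Rintegral_mkcond.
have := loc_integrable_oc a b iu.
move/(integrable_mkcond _ (leb_itv _)).
by apply: eq_integrable => // r _; rewrite /= !patchE; case: ifP.
Qed.

(** Lebesgue differentiation at a point of continuity. *)
Lemma average_cvg u a : continuous u -> forall e, 0 < e ->
  exists2 d, 0 < d & forall tau, 0 < tau -> tau <= d ->
   `|tau^-1 * \int[leb R]_(r in `]a, a + tau]) u r - u a| <= e.
Proof.
move=> cu e e0; have := cu a; move/cvgrPdist_le => /(_ e e0).
move=> /nbhs_ballP[d /= d0 ud]; exists (d / 2); first by rewrite divr_gt0.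
move=> tau t0 td; have iu := continuous_loc_integrable cu.
have ic : loc_integrable (cst (u a)).
  by apply: continuous_loc_integrable; exact: cst_continuous.
have ata : a <= a + tau by rewrite lerDl ltW.
have -> : u a = tau^-1 * \int[leb R]_(r in `]a, a + tau]) u a.
  rewrite Rintegral_cst; last exact: leb_itv.
  by rewrite leb_oc//= addrAC subrr add0r mulrCA mulVf ?mulr1// gt_eqF.
rewrite -mulrBr -RintegralB; last 3 first.
  exact: leb_itv.
  exact: loc_integrable_oc.
  exact: loc_integrable_oc.
rewrite normrM gtr0_norm ?invr_gt0// ler_pdivrMl// mulrC.
rewrite [X in _ <= _ * X](_ : tau = a + tau - a); last by rewrite addrAC subrr add0r.
apply: norm_Rintegral_oc_le; [|exact: ata|].
  apply: continuous_loc_integrable => r; apply: cvgB; first exact: cu.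
  exact: cvg_cst.
move=> r /andP[ar rt]; rewrite distrC; apply: ud.
rewrite /ball/= ltr_norml; apply/andP; split; lra.
Qed.

Lemma integrable_support u a b (M : R) :
    measurable_fun [set: lebR R] (u : lebR R -> R) ->
    (forall r, `|u r| <= M) -> (forall r, ~~ (a < r <= b) -> u r = 0) ->
  (leb R).-integrable setT (EFin \o u).
Proof.
move=> mu uM u0; have iu := bounded_loc_integrable mu uM.
have -> : u = (fun r => \1_(`]a, b]%classic : set R) r * u r).
  apply/funext => r; rewrite indic_oc.
  by have [_|/u0->] := boolP (a < r <= b); rewrite ?mul1r ?mulr0.
exact: (Rintegral_indic_oc a b iu).1.
Qed.

Lemma measurable_indic_oc a b :
  measurable_fun [set: lebR R] (\1_(`]a, b]%classic : set R) : lebR R -> R).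
Proof. by apply: measurable_indic; exact: leb_itv. Qed.

(** As tau tends to 0 the trapezoid tends to the indicator of ]a, b], with an
    L1 error at most 2 tau, so the right-hand side of the test identity tends to
    the integral of w.  The left-hand side is the average of u over ]b, b + tau]
    minus its average over ]a, a + tau], which tends to u b - u a by continuity. *)
Lemma weak_derivative u w (M : R) : continuous u ->
    measurable_fun [set: lebR R] (w : lebR R -> R) ->
    (forall r, `|w r| <= M) ->
    (forall a b tau, a < b -> 0 < tau ->
      \int[leb R]_r (- slope a b tau r * u r) =
      \int[leb R]_r (trapezoid a b tau r * w r)) ->
  forall a b, a < b -> u b - u a = \int[leb R]_(r in `]a, b]) w r.
Proof.
move=> cu mw wM test a b ab; apply/eqP; rewrite -subr_eq0 -normr_le0.
apply/ler_addgt0Pr => e e0; rewrite add0r.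
have M0 : 0 <= M by apply: le_trans (wM 0).
have e3 : 0 < e / 3 by rewrite divr_gt0.
have [da da0 ua] := average_cvg a cu e3.
have [db db0 ub] := average_cvg b cu e3.
(* The last bound on tau makes the L1 error contribute at most e / 3. *)
pose tau := Num.min (Num.min da db) (e / 3 / (2 * (M + 1))).
have M1 : 0 < 2 * (M + 1) by rewrite mulr_gt0// ltr_wpDl.
have t0 : 0 < tau by rewrite !lt_min da0 db0 divr_gt0.
have := ua tau t0; rewrite !ge_min lexx => /(_ isT).
have := ub tau t0; rewrite !ge_min lexx orbT => /(_ isT).
have tM : 2 * M * tau <= e / 3.
  have : tau <= e / 3 / (2 * (M + 1)) by rewrite !ge_min lexx orbT.
  rewrite ler_pdivlMr// => /(le_trans _); apply.
  by rewrite mulrC ler_wpM2l ?ltW//; lra.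
have iu := continuous_loc_integrable cu.
have iw := bounded_loc_integrable mw wM.
have [iua uaE] := Rintegral_indic_oc a (a + tau) iu.
have [iub ubE] := Rintegral_indic_oc b (b + tau) iu.
have [iwab wabE] := Rintegral_indic_oc a b iw.
have mt : measurable_fun [set: lebR R] (trapezoid a b tau : lebR R -> R).
  by apply: continuous_leb_measurable; exact: continuous_trapezoid.
have itw : (leb R).-integrable setT (EFin \o (fun r => trapezoid a b tau r * w r)).
  apply: (@integrable_support _ a (b + tau) M).
  - exact: leb_measurable_funM.
  - move=> r; rewrite normrM; have /andP[T0 T1] := trapezoid_itv r ab t0.
    by rewrite ger0_norm// (le_trans (ler_wpM2l T0 (wM r)))// ler_piMl.
  - by move=> r /(trapezoid_out ab t0) ->; rewrite mul0r.
have diff : `|\int[leb R]_r (trapezoid a b tau r * w r)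
           - \int[leb R]_(r in `]a, b]) w r| <= 2 * M * tau.
  rewrite -wabE -RintegralB//.
  have [iMa MaE] := @Rintegral_indic_oc (cst M) a (a + tau)
    (continuous_loc_integrable (@cst_continuous _ _ M)).
  have [iMb MbE] := @Rintegral_indic_oc (cst M) b (b + tau)
    (continuous_loc_integrable (@cst_continuous _ _ M)).
  apply: le_trans (le_normr_Rintegral _ _) _ => //.
    exact: Rintegrable_sub.
  apply: (@le_trans _ _ (\int[leb R]_r (\1_(`]a, a + tau]%classic : set R) r * M
      + \1_(`]b, b + tau]%classic : set R) r * M))).
    apply: le_Rintegral => //.
    - exact: (integrable_norm (Rintegrable_sub measurableT itw iwab)).
    - exact: Rintegrable_add.
    - move=> r _; rewrite -mulrBl normrM -mulrDl.
      by apply: ler_pM => //; exact: trapezoid_indic.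
  rewrite RintegralD// MaE MbE !Rintegral_cst; try exact: leb_itv.
  rewrite !leb_oc ?lerDl ?(ltW t0)//=.
  by rewrite le_eqVlt; apply/orP; left; apply/eqP; ring.
have slopeE : \int[leb R]_r (- slope a b tau r * u r) =
    tau^-1 * \int[leb R]_(r in `]b, b + tau]) u r
    - tau^-1 * \int[leb R]_(r in `]a, a + tau]) u r.
  rewrite -mulrBr -uaE -ubE -RintegralB// -RintegralZl//; last exact: Rintegrable_sub.
  by apply: eq_Rintegral => r _; rewrite /slope; ring.
move: diff; rewrite -(test a b tau ab t0) slopeE.
set Ia := tau^-1 * _; set Ib := tau^-1 * _; set Iw := \int[_]_(_ in _) _.
rewrite !ler_norml => /andP[? ?] /andP[? ?] /andP[? ?].
apply/andP; split; lra.
Qed.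

End WeakDerivative.

(** * Strong measurability of scalar functions times a vector *)

Section TestFunctions.
Context {R : realType} {s : scalar_kind}.
Notation K := (scalarField R s).
Variable X : normedModType K.
Implicit Types (g : R -> R) (x : X) (a b tau r t : R).

Definition scaled g x : R -> X := fun r => (ofR (g r) : K) *: x.

Lemma L1norm_le (phi : R -> X) g :
    measurable_fun [set: lebR R] ((fun r => rnorm (phi r)) : lebR R -> R) ->
    (leb R).-integrable setT (EFin \o g) ->
    (forall r, rnorm (phi r) <= g r) ->
  (L1norm phi <= (\int[leb R]_r g r)%:E)%E.
Proof.
move=> mphi ig phig; rewrite /L1norm /Rintegral fineK; last exact: integrable_fin_num.
apply: ge0_le_integral.
- exact: measurableT.
- by move=> r _; rewrite lee_fin rnorm_ge0.
- exact/measurable_EFinP.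
- by case/integrableP : ig.
- by move=> r _; rewrite lee_fin.
Qed.

Lemma measurable_rnorm_scaled g x :
  measurable_fun [set: lebR R] (g : lebR R -> R) ->
  measurable_fun [set: lebR R] ((fun r => rnorm (scaled g x r)) : lebR R -> R).
Proof.
move=> mg; rewrite (_ : (fun r => _) = (fun r => `|g r| * rnorm x)).
  apply: leb_measurable_funM; last exact: leb_measurable_cst.
  exact: (measurableT_comp (@normr_measurable _ setT) mg).
by apply/funext => r; rewrite rnormZ_ofR.
Qed.

Lemma L1norm_scaled_lty g x : (leb R).-integrable setT (EFin \o g) ->
  (L1norm (scaled g x) < +oo)%E.
Proof.
move=> ig; have mg : measurable_fun [set: lebR R] (g : lebR R -> R).
  by apply/measurable_EFinP; case/integrableP : ig.
have ing := integrable_norm ig.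
have ih : (leb R).-integrable setT (EFin \o (fun r => rnorm x * `|g r|)).
  by apply: eq_integrable (integrableZl measurableT (rnorm x) ing) => // r _.
apply: le_lt_trans (L1norm_le _ ih _) _; last exact: ltry.
  exact: measurable_rnorm_scaled.
by move=> r; rewrite rnormZ_ofR mulrC.
Qed.

(** Layer-cake approximation: superlevel sets overlap, so the code is not a
    partition, but at r it sums to g(r) rounded down to a multiple of 1/(n+1).
    Every level is positive, so the sets stay inside the support of g and have
    finite measure. *)
Definition layer_code g x (n : nat) : @simple_code R s X :=
  [seq ([set r | i.+1%:R / n.+1%:R <= g r], (ofR n.+1%:R^-1 : K) *: x)
     | i <- iota 0 n.+1].

Lemma layer_codeE g x n r : 0 <= g r <= 1 ->
  simple_eval (layer_code g x n) r
  = (ofR ((Num.truncn (n.+1%:R * g r))%:R / n.+1%:R) : K) *: x.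
Proof.
move=> /andP[g0 g1]; have n0 : 0 < n.+1%:R :> R by rewrite ltr0n.
have T0 : 0 <= n.+1%:R * g r by rewrite mulr_ge0.
set T := Num.truncn _.
have Tn : (T <= n.+1)%N.
  rewrite -(ler_nat R); have /andP[+ _] := truncn_itv T0.
  by move=> /le_trans; apply; rewrite ler_piMr// ltW.
rewrite /simple_eval /layer_code big_map.
transitivity (\sum_(0 <= i < n.+1 | (i < T)%N) (ofR n.+1%:R^-1 : K) *: x).
  rewrite [RHS]big_mkcond; apply: eq_big_seq => i _ /=.
  suff -> : (r \in [set r0 | i.+1%:R / n.+1%:R <= g r0]) = (i < T)%N by [].
  rewrite /T truncn_gt_nat; apply/idP/idP.
    by rewrite inE /= ler_pdivrMr// mulrC.
  by rewrite inE /= ler_pdivrMr// [g r * _]mulrC.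
rewrite -(big_nat_widen _ _ _ xpredT)//= sumr_const_nat subn0.
rewrite -scaler_nat scalerA; congr (_ *: x).
have -> : T%:R = ofR T%:R :> K.
  by elim: T {Tn} => [|T IH]; rewrite ?ofR0// -!natr1 ofRD IH ofR1.
by rewrite -ofRM.
Qed.

Lemma measurable_superlevel g (c : R) :
  measurable_fun [set: lebR R] (g : lebR R -> R) ->
  measurable ([set r | c <= g r] : set (lebR R)).
Proof.
move=> mg; have := mg measurableT _ (measurable_itv `[c, +oo[).
rewrite setTI; set B := (X in measurable X) => mB; set A := (X in measurable X).
suff -> : A = B by [].
by apply/seteqP; split => r; rewrite /A /B /= in_itv/= andbT.
Qed.

Lemma strongly_measurable_scaled g x a b :
    measurable_fun [set: lebR R] (g : lebR R -> R) ->
    (forall r, 0 <= g r <= 1) -> (forall r, ~~ (a < r <= b) -> g r = 0) ->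
  strongly_measurable (scaled g x).
Proof.
move=> mg g01 gout; exists (layer_code g x); split.
  move=> n i; rewrite size_map size_iota => ni /=.
  rewrite (nth_map 0%N) ?size_iota// nth_iota//= add0n.
  have mA := measurable_superlevel (i.+1%:R / n.+1%:R) mg.
  split=> //; apply: (@le_lt_trans _ _ (leb R (`[a, b]%classic : set (lebR R)))).
    apply: le_measure; rewrite ?inE//; first exact: leb_itv.
    move=> r; rewrite /= in_itv/= => ig.
    apply: contrapT => /negP abr; move: ig; rewrite gout; last first.
      by apply: contra abr => /andP[/ltW -> ->].
    by apply/negP; rewrite -ltNge divr_gt0.
  exact: leb_cc_lty.
apply: aeW => r _; apply/rcvgP => e e0.
have x1 : 0 < rnorm x + 1 by rewrite ltr_wpDl ?rnorm_ge0.
have ex0 : 0 < e / (rnorm x + 1) by rewrite divr_gt0.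
near=> n.
rewrite layer_codeE// -scalerBl -ofRN -ofRD rnormZ_ofR.
have n0 : 0 < n.+1%:R :> R by rewrite ltr0n.
have /andP[g0 g1] := g01 r.
have /truncn_itv/andP[T0 T1] : 0 <= n.+1%:R * g r by rewrite mulr_ge0.
set T := (Num.truncn _)%:R in T0 *.
have Tg : `|g r - T / n.+1%:R| <= n.+1%:R^-1.
  rewrite ger0_norm; last by rewrite subr_ge0 ler_pdivrMr// mulrC.
  rewrite lerBlDr -[X in X + _]mul1r -mulrDl ler_pdivlMr// mulrC.
  by rewrite addrC natr1 ltW.
apply: (@le_trans _ _ (n.+1%:R^-1 * (rnorm x + 1))).
  by apply: ler_pM => //; [exact: rnorm_ge0|rewrite lerDl].
rewrite -ler_pdivlMr//; apply: ltW; near: n; exact: (near_infty_natSinv_lt (PosNum ex0)).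
Unshelve. all: by end_near.
Qed.

Lemma L1_scaled g x a b :
    measurable_fun [set: lebR R] (g : lebR R -> R) ->
    (forall r, 0 <= g r <= 1) -> (forall r, ~~ (a < r <= b) -> g r = 0) ->
  L1 (scaled g x).
Proof.
move=> mg g01 gout; split; first exact: strongly_measurable_scaled gout.
apply: L1norm_scaled_lty; apply: (@integrable_support _ _ a b 1) => // r.
by have /andP[g0 g1] := g01 r; rewrite ger0_norm.
Qed.

End TestFunctions.

(** * Trapezoids lie in the domain of the generator *)

Section TestGenerator.
Context {R : realType} {s : scalar_kind}.
Notation K := (scalarField R s).
Variable X : normedModType K.
Implicit Types (x : X) (a b c tau r t : R).

(** The error of the difference quotient for the positive part of r - c, whose
    derivative is 1 to the right of c and 0 to its left. *)
Definition kink_error t c r : R :=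
  t^-1 * (Num.max 0 (r - t - c) - Num.max 0 (r - c)) + (c < r)%R%:R.

(** Translation by t moves no point across c unless it lies within |t| of c;
    elsewhere the quotient is exact.  Within that window the quotient lies in
    [-1, 0] because the positive part is nondecreasing and 1-Lipschitz. *)
Lemma kink_error_le t c r : t != 0 ->
  `|kink_error t c r| <= \1_(`]c - `|t|, c + `|t|]%classic : set R) r.
Proof.
move=> t0; rewrite indic_oc /kink_error.
set q1 := Num.max 0 (r - t - c); set q2 := Num.max 0 (r - c).
set A := t^-1 * _.
have At : A * t = q1 - q2 by rewrite /A mulrAC mulVf// mul1r.
have tE : t^-1 * t = 1 by rewrite mulVf.
have q1E : q1 = r - t - c \/ q1 = 0 /\ r - t - c <= 0.
  by rewrite /q1; case: (leP 0 (r - t - c)) => ?; [left|right; split=> //; exact: ltW].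
have q10 : 0 <= q1 by rewrite /q1 le_max lexx.
have q1r : r - t - c <= q1 by rewrite /q1 le_max lexx orbT.
have q20 : 0 <= q2 by rewrite /q2 le_max lexx.
have q2r : r - c <= q2 by rewrite /q2 le_max lexx orbT.
have q2E : q2 = r - c /\ 0 <= r - c \/ q2 = 0 /\ r - c <= 0.
  rewrite /q2; case: (leP 0 (r - c)) => ?; [left|right; split=> //; exact: ltW].
  by split.
have A01 : -1 <= A <= 0.
  have [tp|tn|te] := ltgtP 0 t; last by rewrite -te eqxx in t0.
    by rewrite /A mulrC ler_pdivlMr// ler_pdivrMr//; apply/andP; split; lra.
  by rewrite /A mulrC ler_ndivlMr// ler_ndivrMr//; apply/andP; split; lra.
have [cr|rc] := ltP c r.
  have [rt|tr] := leP r (c + `|t|).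
    have -> : c - `|t| < r by rewrite (le_lt_trans _ cr)// gerBl.
    by rewrite ler_norml /=; case/andP: A01 => *; apply/andP; split; lra.
  have tle : t <= `|t| := ler_norm t.
  have {}At : A * t = - t.
    by rewrite At; case: q1E => [|[]] *; case: q2E => -[] *; lra.
  have -> : A = -1 by apply: (mulIf t0); rewrite At mulN1r.
  by rewrite addNr normr0.
have -> /= : (r <= c + `|t|) by rewrite (le_trans rc)// lerDl.
rewrite addr0 andbT; have [_|tr] := ltP (c - `|t|) r.
  by rewrite ler_norml /=; case/andP: A01 => *; apply/andP; split; lra.
have tle : - t <= `|t| by rewrite -normrN; exact: ler_norm.
have {}At : A * t = 0.
  by rewrite At; case: q1E => [|[]] *; case: q2E => -[] *; lra.
have -> : A = 0 by apply: (mulIf t0); rewrite At mul0r.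
by rewrite normr0.
Qed.

Lemma trapezoid_difference a b tau t r : a < b -> 0 < tau -> t != 0 ->
  t^-1 * (trapezoid a b tau (r - t) - trapezoid a b tau r) + slope a b tau r =
  tau^-1 * (kink_error t a r - kink_error t (a + tau) r
            - (kink_error t b r - kink_error t (b + tau) r)).
Proof.
move=> ab t0 tn0; rewrite /kink_error /slope /trapezoid /ramp !indic_oc.
have step c : ((c < r) && (r <= c + tau))%R%:R = (c < r)%R%:R - (c + tau < r)%R%:R :> R.
  have [rt|tr] := leP r (c + tau); first by rewrite subr0 andbT.
  by rewrite (le_lt_trans _ tr) ?subrr// lerDl ltW.
rewrite !step !opprD !addrA.
set p1 := Num.max 0 (r - t - a); set p2 := Num.max 0 (r - t - a - tau).
set p3 := Num.max 0 (r - t - b); set p4 := Num.max 0 (r - t - b - tau).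
set p5 := Num.max 0 (r - a); set p6 := Num.max 0 (r - a - tau).
set p7 := Num.max 0 (r - b); set p8 := Num.max 0 (r - b - tau).
by field; rewrite tn0 gt_eqF.
Qed.

Lemma measurable_slope a b tau :
  measurable_fun [set: lebR R] (slope a b tau : lebR R -> R).
Proof.
apply: leb_measurable_funM; last exact: leb_measurable_cst.
by apply: leb_measurable_funB; exact: measurable_indic_oc.
Qed.

Lemma L1_slope a b tau x : 0 < tau -> L1 (scaled (fun r => - slope a b tau r) x).
Proof.
move=> t0; split; last first.
  apply: L1norm_scaled_lty.
  have i1 c d : (leb R).-integrable setT
      (EFin \o (fun r => \1_(`]c, d]%classic : set R) r * 1)).
    have l1 := continuous_loc_integrable (@cst_continuous _ _ (1 : R)).
    exact: (Rintegral_indic_oc c d l1).1.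
  have := integrableZl measurableT (- tau^-1)
    (Rintegrable_sub measurableT (i1 a (a + tau)) (i1 b (b + tau))).
  apply: eq_integrable => // r _ /=.
  by rewrite -EFinM !mulr1 /slope mulNr mulrC.
exists (fun=> [:: (`]a, a + tau]%classic, (ofR (- tau^-1) : K) *: x);
                  (`]b, b + tau]%classic, (ofR (tau^-1) : K) *: x)]); split.
  move=> n [|[|//]] _ /=; (split; first exact: leb_itv); rewrite leb_oc ?ltry//.
    by rewrite lerDl ltW.
  by rewrite lerDl ltW.
apply: aeW => r _; rewrite (_ : scaled _ _ _ = simple_eval
   [:: (`]a, a + tau]%classic, (ofR (- tau^-1) : K) *: x);
       (`]b, b + tau]%classic, (ofR (tau^-1) : K) *: x)] r); first exact: cvg_cst.
rewrite /simple_eval !big_cons big_nil /= addr0 /scaled /slope !indicE.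
case: (r \in _); case: (r \in _);
  rewrite ?subr0 ?sub0r ?subrr ?mul0r ?mulNr ?mul1r ?addr0 ?add0r ?opprK//.
- by rewrite oppr0 ofR0 scale0r ofRN scaleNr addNr.
- by rewrite oppr0 ofR0 scale0r.
Qed.

(** The generator is minus the derivative, hence the sign of the slope.  The
    difference quotient is exact outside windows of width 2|t| around the four
    corners and bounded by 1/tau inside them, so the error is at most
    8 |t| |x| / tau in L1 norm. *)
Lemma trapezoid_generator a b tau x : a < b -> 0 < tau ->
  is_generator (scaled (trapezoid a b tau) x)
               (scaled (fun r => - slope a b tau r) x).
Proof.
move=> ab t0; have mt : measurable_fun [set: lebR R] (trapezoid a b tau : lebR R -> R).
  by apply: continuous_leb_measurable; exact: continuous_trapezoid.
split.
- apply: (L1_scaled _ mt); first by move=> r; exact: trapezoid_itv.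
  by move=> r; exact: trapezoid_out.
- exact: L1_slope.
pose d t r := t^-1 * (trapezoid a b tau (r - t) - trapezoid a b tau r) + slope a b tau r.
have dE t r : (ofR t^-1 : K) *: (translation t (scaled (trapezoid a b tau) x) r
       - scaled (trapezoid a b tau) x r) - scaled (fun r => - slope a b tau r) x r
    = scaled (d t) x r.
  rewrite /translation /scaled -scalerBl scalerA -scalerBl -ofRN -ofRD -ofRM.
  by rewrite -ofRN -ofRD opprK.
have i1 : loc_integrable (cst (1 : R)).
  by apply: continuous_loc_integrable; exact: cst_continuous.
(* I t c bounds the error at the corner c; the factor 1 is the shape expected
   by [Rintegral_indic_oc]. *)
pose C := tau^-1 * rnorm x.
pose I t c r : R := \1_(`]c - `|t|, c + `|t|]%classic : set R) r * 1.
have iI t c : (leb R).-integrable setT (EFin \o I t c) := (Rintegral_indic_oc _ _ i1).1.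
have vI t c : \int[leb R]_r (I t c r) = 2 * `|t|.
  rewrite (Rintegral_indic_oc _ _ i1).2 Rintegral_cst; last exact: leb_itv.
  by rewrite leb_oc /=; [ring|rewrite lerD2l ge0_cp].
pose S t r := (I t a r + I t (a + tau) r) + (I t b r + I t (b + tau) r).
have iS t : (leb R).-integrable setT (EFin \o S t).
  by apply: Rintegrable_add => //; apply: Rintegrable_add.
have C0 : 0 <= C by rewrite mulr_ge0 ?rnorm_ge0// invr_ge0 ltW.
have bound t : t != 0 -> (L1norm (scaled (d t) x) <= (C * (8 * `|t|))%:E)%E.
  move=> tn0.
  have -> : C * (8 * `|t|) = \int[leb R]_r (C * S t r).
    rewrite RintegralZl//; congr (_ * _).
    rewrite /S !RintegralD//; try exact: Rintegrable_add.
    by rewrite !vI; ring.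
  apply: L1norm_le.
  - apply: measurable_rnorm_scaled.
    apply: leb_measurable_funD; last exact: measurable_slope.
    apply: leb_measurable_funM; first exact: leb_measurable_cst.
    apply: leb_measurable_funB; last exact: mt.
    apply: continuous_leb_measurable => r.
    apply: (@continuous_comp _ _ _ (fun r => r - t) (trapezoid a b tau)).
      by apply: cvgB; [exact: cvg_id|exact: cvg_cst].
    exact: continuous_trapezoid.
  - by apply: eq_integrable (integrableZl measurableT C (iS t)).
  - move=> r; rewrite rnormZ_ofR /d trapezoid_difference// normrM.
    rewrite gtr0_norm ?invr_gt0// mulrAC /C ler_wpM2l//.
    apply: le_trans (ler_normB _ _) _; rewrite /S /I !mulr1.
    by apply: lerD; apply: le_trans (ler_normB _ _) _; apply: lerD; exact: kink_error_le.
apply: (@squeeze_cvge _ _ _ _ (cst 0%E) _ (fun t => (C * (8 * `|t|))%:E)).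
- near=> t; apply/andP; split.
    by apply: integral_ge0 => r _; rewrite lee_fin rnorm_ge0.
  have tn0 : t != 0 by near: t; exact: nbhs_dnbhs_neq.
  by apply: le_trans (bound t tn0); rewrite /L1norm; under eq_integral do rewrite dE.
- exact: cvg_cst.
- apply: cvg_EFin; first by near=> t.
  apply: cvg_within_filter.
  have : (fun t : R => C * (8 * `|t|)) @ (0 : R) --> C * (8 * `|0 : R|).
    apply: cvgM; first exact: cvg_cst.
    apply: cvgM; first exact: cvg_cst.
    exact: norm_continuous.
  by rewrite normr0 !mulr0.
Unshelve. all: by end_near.
Qed.

End TestGenerator.

(** * The resolvent equation in integrated form *)

Section AdjointGenerator.
Context {R : realType} {s : scalar_kind}.
Notation K := (scalarField R s).
Variable X : normedModType K.
Implicit Types (x : X) (a b t : R) (u v w : R -> R) (g h k f : R -> dual X).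

Lemma eq_ae_Rintegral (D : set (lebR R)) u v : measurable D ->
    measurable_fun [set: lebR R] (u : lebR R -> R) ->
    measurable_fun [set: lebR R] (v : lebR R -> R) ->
    {ae leb R, forall r : lebR R, u r = v r} ->
  \int[leb R]_(r in D) u r = \int[leb R]_(r in D) v r.
Proof.
move=> mD mu mv uv; rewrite /Rintegral; congr fine; apply: ae_eq_integral.
- exact: mD.
- exact/measurable_EFinP/measurable_funTS.
- exact/measurable_EFinP/measurable_funTS.
- by apply: filterS uv => r uvr _; rewrite uvr.
Qed.

(** Replaces an essentially bounded function by an everywhere bounded one, to
    which the pointwise estimates above apply. *)
Lemma truncation v (M : R) :
    measurable_fun [set: lebR R] (v : lebR R -> R) ->
    {ae leb R, forall r : lebR R, `|v r| <= M} ->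
  exists w, [/\ measurable_fun [set: lebR R] (w : lebR R -> R),
    forall r, `|w r| <= `|M| & {ae leb R, forall r : lebR R, v r = w r}].
Proof.
move=> mv vM; exists (fun r => Num.max (- `|M|) (Num.min `|M| (v r))); split.
- exact: (measurable_maxr (leb_measurable_cst _)
    (measurable_minr (leb_measurable_cst _) mv)).
- by move=> r; rewrite ler_norml le_max lexx ge_max ge_min lexx ge0_cp.
- apply: filterS vM => r /le_trans/(_ (ler_norm M)).
  by rewrite ler_norml => /andP[vl vr]; rewrite min_r// max_r.
Qed.

Lemma Linf_wstar_bounded g : Linf_wstar g ->
  exists M, {ae leb R, forall r : lebR R, rnorm (g r) <= M}.
Proof.
move=> [_] /andP[_]; rewrite inE /= /finite_norm unlock /Lnorm ifT; last first.
  apply: (@lt_le_trans _ _ (leb R (`[0, 1]%classic : set (lebR R)))).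
    by rewrite leb_cc// subr0 lte_fin.
  by apply: le_measure; rewrite ?inE//; exact: leb_itv.
move=> /ess_supr_bounded[M gM]; exists M; apply: filterS gM => r.
exact/le_trans/ler_norm.
Qed.

Lemma part_sintegral c (D : set R) (G : R -> K) :
  part c (Defs.sintegral D G) = \int[leb R]_(r in D) part c (G r).
Proof.
rewrite /Defs.sintegral part_mkscalar; case: c => //.
rewrite /part /sIm; move: G; rewrite /scalarField; case: s => //= G.
by rewrite /Rintegral integral0.
Qed.

Lemma part_sprimitive c (G : R -> K) t :
  part c (sprimitive G t) = primitive (fun r => part c (G r)) t.
Proof. by rewrite /sprimitive /primitive; case: ifP; rewrite ?partN part_sintegral. Qed.

Lemma dual_apply_ofR (y : dual X) (l : R) x : y ((ofR l : K) *: x) = (ofR l : K) * y x.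
Proof. exact: linearZ. Qed.

Lemma part_pairing_scaled c g (z : R -> R) x :
  part c (pairing g (scaled z x)) = \int[leb R]_r (z r * part c (g r x)).
Proof.
rewrite /pairing part_sintegral; apply: eq_Rintegral => r _.
by rewrite /scaled dual_apply_ofR part_ofRM.
Qed.

Lemma norm_part_apply c (y : dual X) x : `|part c (y x)| <= rnorm y * rnorm x.
Proof. exact: le_trans (norm_part _ _) (rnorm_dual_apply _ _). Qed.

Lemma continuous_part_apply c h x : continuous h ->
  continuous (fun r => part c (h r x)).
Proof.
move=> ch r; apply/cvgrPdist_le => e e0.
have x1 : 0 < rnorm x + 1 by rewrite ltr_wpDl ?rnorm_ge0.
have /rcvgP := ch r; move=> /(_ _ (divr_gt0 e0 x1)).
apply: filterS => t ht; rewrite -partB.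
apply: le_trans (norm_part_apply c (h r - h t) x) _.
have n0 := rnorm_ge0 x.
rewrite ler_pdivlMr// in ht; apply: le_trans ht.
by rewrite ler_wpM2l ?rnorm_ge0// lerDl.
Qed.

Lemma smeasurable_part c (G : R -> K) : smeasurable G ->
  measurable_fun [set: lebR R] ((fun r => part c (G r)) : lebR R -> R).
Proof. by case=> mr mi; case: c. Qed.

(** Testing the adjoint relation against a trapezoid times x turns it into the
    hypothesis of [weak_derivative] for the pairings with x.  The function w is a
    bounded version of the pairing of k with x. *)
Lemma adjoint_generator_weak_derivative h k c x : continuous h ->
    is_adjoint_generator h k ->
  exists w, [/\ loc_integrable w,
    {ae leb R, forall r : lebR R, part c (k r x) = w r}
    & forall a b, a < b ->
      part c (h b x) - part c (h a x) = \int[leb R]_(r in `]a, b]) w r].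
Proof.
move=> ch [Lh Lk hk]; have [M kM] := Linf_wstar_bounded Lk.
have mk := smeasurable_part c (Lk.1 x).
have [|w [mw wM kw]] := @truncation _ (M * rnorm x) mk.
  apply: filterS kM => r krM; apply: le_trans (norm_part_apply _ _ _) _.
  by rewrite ler_wpM2r// rnorm_ge0.
exists w; split=> //; first exact: bounded_loc_integrable wM.
apply: (weak_derivative (M := `|M * rnorm x|)) => //.
  exact: continuous_part_apply.
move=> a b tau ab t0.
have := hk _ _ (trapezoid_generator x ab t0) => /(congr1 (part c)).
rewrite !part_pairing_scaled => ->.
have mt : measurable_fun [set: lebR R] (trapezoid a b tau : lebR R -> R).
  by apply: continuous_leb_measurable; exact: continuous_trapezoid.
apply: eq_ae_Rintegral; first exact: measurableT.
- exact: leb_measurable_funM mt _.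
- exact: leb_measurable_funM mt _.
- by apply: filterS kw => r ->.
Qed.

(** Integrates the identity f = h - h', which is what (1 - B^* ) h = f means
    after pairing with x. *)
Lemma resolvent_primitive f h c x t : Linf_wstar f -> continuous h ->
    is_adjoint_resolvent 1 f h ->
  part c (sprimitive (fun r => f r x) t) =
  primitive (fun r => part c (h r x)) t - (part c (h t x) - part c (h 0 x)).
Proof.
move=> Lf ch [k Ghk khf].
have [w [iw kw hw]] := adjoint_generator_weak_derivative c x ch Ghk.
have ih : loc_integrable (fun r => part c (h r x)).
  exact/continuous_loc_integrable/continuous_part_apply.
have mf := smeasurable_part c (Lf.1 x).
have fE : {ae leb R, forall r : lebR R,
    part c (f r x) = part c (h r x) - w r}.
  apply: filterS2 kw (khf x) => r <- <-.
  by rewrite dualB dualZ partB part_ofRM mul1r.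
have mhw : measurable_fun [set: lebR R]
    ((fun r => part c (h r x) - w r) : lebR R -> R).
  by apply: leb_measurable_funB; [exact: ih.1|exact: iw.1].
have ftc a b : a <= b -> \int[leb R]_(r in `[a, b]) part c (f r x) =
    \int[leb R]_(r in `[a, b]) part c (h r x) - (part c (h b x) - part c (h a x)).
  move=> ab; rewrite (eq_ae_Rintegral (leb_itv _) mf mhw fE).
  rewrite RintegralB; [|exact: leb_itv|exact: ih.2|exact: iw.2].
  congr (_ - _); move: ab; rewrite le_eqVlt => /predU1P[->|ab].
    rewrite subrr Rintegral_cc_oc// set_itv_ge ?Rintegral_set0//.
    by rewrite bnd_simp ltxx.
  by rewrite (hw _ _ ab) Rintegral_cc_oc// ltW.
rewrite part_sprimitive /primitive; case: leP => [t0|/ltW t0]; rewrite (ftc _ _ t0)//.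
by rewrite opprD opprK opprB.
Qed.

End AdjointGenerator.

(** * Bochner integrals in the dual *)

Section BochnerIntegral.
Context {R : realType} {s : scalar_kind}.
Notation K := (scalarField R s).
Variable X : normedModType K.
Implicit Types (x : X) (h : R -> dual X).

Lemma simple_ok_cons (p : set R * dual X) (C : simple_code (dual X)) :
  simple_ok (p :: C) ->
  [/\ measurable (p.1 : set (lebR R)), (leb R (p.1 : set (lebR R)) < +oo)%E
    & simple_ok C].
Proof.
move=> ok; have [mp pfin] := ok 0%N isT.
by split=> // i iC; exact: (ok i.+1).
Qed.

(** The offset y is there for the induction on the code: peeling off one
    term adds its vector to y on one set and leaves y unchanged off that set. *)
Lemma measurable_simple_distance h (C : simple_code (dual X)) (y : dual X) :
    continuous h -> simple_ok C ->
  measurable_fun [set: lebR R]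
    ((fun r => rnorm (h r - (y + simple_eval C r))) : lebR R -> R).
Proof.
move=> ch; elim: C y => [y _|p C IH y /simple_ok_cons[mp _ okC]].
  apply: continuous_leb_measurable => r; apply/cvgrPdist_le => e e0.
  have /rcvgP := ch r; move=> /(_ _ e0); apply: filterS => t; apply: le_trans.
  rewrite /simple_eval !big_nil !addr0; apply: le_trans (rnorm_dist _ _) _.
  by rewrite opprB addrA subrK.
have mi : measurable_fun [set: lebR R] (\1_(p.1) : lebR R -> R).
  exact: measurable_indic.
rewrite (_ : (fun r => _) = (fun r =>
    \1_(p.1) r * rnorm (h r - (y + p.2 + simple_eval C r))
    + (1 - \1_(p.1) r) * rnorm (h r - (y + simple_eval C r)))).
  apply: leb_measurable_funD; apply: leb_measurable_funM.
  - exact: mi.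
  - exact: IH.
  - exact: leb_measurable_funB (leb_measurable_cst 1) mi.
  - exact: IH.
apply/funext => r; rewrite /simple_eval big_cons indicE; case: ifP => _.
  by rewrite mul1r subrr mul0r addr0 addrA.
by rewrite mul0r subr0 mul1r !add0r.
Qed.

Lemma simple_integral_part c (D : set (lebR R)) (C : simple_code (dual X)) x :
    measurable D -> (leb R D < +oo)%E -> simple_ok C ->
  (leb R).-integrable D (EFin \o (fun r => part c (dual_fun (simple_eval C r) x))) /\
  part c (dual_fun (simple_integral D C) x) =
    \int[leb R]_(r in D) part c (dual_fun (simple_eval C r) x).
Proof.
move=> mD Dfin; elim: C => [_|p C IH /simple_ok_cons[mp _ /IH[iC CE]]].
  have -> : (fun r => part c (dual_fun (simple_eval [::] r) x)) = cst 0.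
    by apply/funext => r; rewrite /simple_eval big_nil part0.
  rewrite /simple_integral big_nil part0 Rintegral_cst// mul0r; split=> //.
  exact: integrable0.
have mi : measurable_fun [set: lebR R] (\1_(p.1) : lebR R -> R).
  exact: measurable_indic.
have ii : (leb R).-integrable D (EFin \o (\1_(p.1) : lebR R -> R)).
  apply: (@bounded_integrable _ _ _ 1) => // r _.
  by rewrite indicE; case: (_ \in _); rewrite ?normr1 ?normr0.
have ip : (leb R).-integrable D (EFin \o (fun r => part c (dual_fun p.2 x) * \1_(p.1) r)).
  by apply: eq_integrable (integrableZl mD (part c (dual_fun p.2 x)) ii).
have evalE r : part c (dual_fun (simple_eval (p :: C) r) x)
    = part c (dual_fun p.2 x) * \1_(p.1) r + part c (dual_fun (simple_eval C r) x).
  rewrite /simple_eval big_cons dualD partD indicE; congr (_ + _).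
  by case: ifP => _; rewrite ?mulr1 ?mulr0 // part0.
have -> : (fun r => part c (dual_fun (simple_eval (p :: C) r) x)) =
    (fun r => part c (dual_fun p.2 x) * \1_(p.1) r
              + part c (dual_fun (simple_eval C r) x)).
  exact/funext.
split; first exact: Rintegrable_add.
rewrite RintegralD// RintegralZl// -CE /simple_integral big_cons dualD partD.
by rewrite dualZ part_ofRM mulrC /Rintegral integral_indic.
Qed.

(** Pairing with x is continuous for the norm of the dual, so it commutes with
    the limit of the integrals of the simple functions; for the latter the identity
    is [simple_integral_part]. *)
Lemma bochner_integral_part c (D : set (lebR R)) h (I : dual X) x :
    measurable D -> (leb R D < +oo)%E -> continuous h ->
    (leb R).-integrable D (EFin \o (fun r => part c (h r x))) ->
    is_bochner_integral D h I ->
  part c (I x) = \int[leb R]_(r in D) part c (h r x).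
Proof.
move=> mD Dfin ch ih [C [[okC _] C0 CI]].
apply/eqP; rewrite -subr_eq0 -normr_le0; apply/ler_addgt0Pr => e e0; rewrite add0r.
have x1 : 0 < rnorm x + 1 by rewrite ltr_wpDl ?rnorm_ge0.
have d0 : 0 < e / 2 / (rnorm x + 1) by rewrite !divr_gt0.
set E := fun n => _ in C0.
near \oo => n.
have Cn : rnorm (I - simple_integral D (C n)) <= e / 2 / (rnorm x + 1).
  by near: n; move/rcvgP : CI => /(_ _ d0).
have En : (E n <= (e / 2 / (rnorm x + 1))%:E)%E.
  by apply: ltW; near: n; exact: (C0 _ (nbhs_open_ereal_lt (f := fun=> _) d0)).
have [iC CE] := simple_integral_part c x mD Dfin (okC n).
have xb : e / 2 / (rnorm x + 1) * rnorm x <= e / 2.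
  rewrite -[leRHS](divfK (lt0r_neq0 x1)) ler_wpM2l ?ltW//.
  by rewrite ltrDl.
have e1 : `|part c (I x) - part c (dual_fun (simple_integral D (C n)) x)| <= e / 2.
  rewrite -partB -dualB; apply: le_trans xb.
  by rewrite (le_trans (norm_part_apply _ _ _))// ler_wpM2r// rnorm_ge0.
have e2 : `|part c (dual_fun (simple_integral D (C n)) x)
      - \int[leb R]_(r in D) part c (h r x)| <= e / 2.
  rewrite CE -RintegralB// -lee_fin EFin_normr_Rintegral//; last exact: Rintegrable_sub.
  have iB := Rintegrable_sub mD iC ih.
  apply: le_trans (le_abse_integral _ mD _) _; first by case/integrableP : iB.
  apply: (@le_trans _ _ ((rnorm x)%:E * E n)%E); last first.
    apply: (@le_trans _ _ ((rnorm x)%:E * (e / 2 / (rnorm x + 1))%:E)%E).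
      by rewrite lee_wpmul2l// lee_fin rnorm_ge0.
    by rewrite -EFinM lee_fin mulrC.
  have mE : measurable_fun [set: lebR R]
      ((fun r => rnorm (h r - simple_eval (C n) r)) : lebR R -> R).
    have := measurable_simple_distance 0 ch (okC n).
    by congr measurable_fun; apply/funext => r; rewrite add0r.
  have mED : measurable_fun D
      (EFin \o (fun r => rnorm (h r - simple_eval (C n) r))).
    exact/measurable_EFinP/measurable_funTS.
  have x0 : (0 <= (rnorm x)%:E)%E by rewrite lee_fin rnorm_ge0.
  have E0 r : D r -> (0 <= (rnorm (h r - simple_eval (C n) r))%:E)%E.
    by rewrite lee_fin rnorm_ge0.
  rewrite /E -(ge0_integralZl (leb R) mD mED E0 x0).
  apply: ge0_le_integral.
  - exact: mD.
  - by move=> r _; rewrite abse_ge0.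
  - case/integrableP : iB => miB _.
    exact: (measurableT_comp (@abse_measurable _ setT) miB).
  - exact: (emeasurable_funM (measurable_cst _) mED).
  - move=> r _ /=; rewrite -EFinM lee_fin -partB -dualB mulrC rnorm_distC.
    exact: norm_part_apply.
rewrite (splitr e); apply: le_trans (lerD e1 e2).
exact: ler_distD.
Unshelve. all: by end_near.
Qed.

Lemma bochner_primitive_part c h t (I : dual X) x : continuous h ->
    is_bochner_primitive_at h t I ->
  part c (I x) = primitive (fun r => part c (h r x)) t.
Proof.
move=> ch; have ih : loc_integrable (fun r => part c (h r x)).
  exact/continuous_loc_integrable/continuous_part_apply.
rewrite /is_bochner_primitive_at /primitive; case: ifP => _ hI.
  apply: bochner_integral_part hI => //; [exact: leb_itv|exact: leb_cc_lty|].
  exact: ih.2.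
apply: oppr_inj; rewrite opprK -partN -dualN.
apply: bochner_integral_part hI => //; [exact: leb_itv|exact: leb_cc_lty|].
exact: ih.2.
Qed.

End BochnerIntegral.

(** * Completeness of the dual, and Rosenthal's lemma *)

Section Completeness.
Context {R : realType} {s : scalar_kind}.
Notation K := (scalarField R s).

Definition cauchy_sequence (Y : normedModType K) (y : nat -> Y) :=
  forall e : R, 0 < e -> exists N, forall m n, (N <= m)%N -> (N <= n)%N ->
    rnorm (y m - y n) <= e.

Lemma real_cauchy_cvg (u : nat -> R) :
    (forall e, 0 < e -> exists N, forall m n, (N <= m)%N -> (N <= n)%N ->
      `|u m - u n| <= e) ->
  exists l, forall e, 0 < e -> exists N, forall n, (N <= n)%N -> `|l - u n| <= e.
Proof.
move=> uC; have : cvg (u @ \oo).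
  apply/cauchy_cvgP/cauchy_ballP => e e0.
  have [N uN] : exists N, forall m n, (N <= m)%N -> (N <= n)%N -> `|u m - u n| <= e / 2.
    by apply: uC; rewrite divr_gt0.
  exists (u @` [set n | (N <= n)%N], u @` [set n | (N <= n)%N]).
    by split; exists N => // n /= Nn; exists n.
  move=> [_ _] /= [[m Nm <-] [n Nn <-]]; rewrite /ball/=.
  by rewrite (le_lt_trans (uN _ _ Nm Nn))// ltr_pdivrMr// ltr_pMr// ltr1n.
move=> /cvg_ex[l /cvgrPdist_le ul]; exists l => e /ul[N _ uN].
by exists N => n Nn; exact: uN.
Qed.

Lemma norm_part_mkscalar c (a b : R) (k : K) :
  `|part c (mkscalar a b - k)| <= `|(if c then a else b) - part c k|.
Proof.
rewrite partB part_mkscalar; case: c => //.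
rewrite /part /sIm; move: k; rewrite /scalarField; case: s => //= k.
by rewrite subrr normr0.
Qed.

Lemma scalar_complete (u : nat -> K^o) : cauchy_sequence u ->
  exists l : K^o, u @ \oo --> l.
Proof.
move=> uC; have partC c : exists l, forall e, 0 < e -> exists N, forall n,
    (N <= n)%N -> `|l - part c (u n)| <= e.
  apply: real_cauchy_cvg => e /uC[N uN]; exists N => m n Nm Nn.
  by rewrite -partB (le_trans (norm_part _ _))//; exact: uN.
have [a ua] := partC true; have [b ub] := partC false.
exists (mkscalar a b); apply/rcvgP => e e0.
have e2 : 0 < e / 2 by rewrite divr_gt0.
have [Na uNa] := ua _ e2; have [Nb uNb] := ub _ e2.
exists (maxn Na Nb) => // n /=; rewrite geq_max => /andP[an bn].
rewrite (le_trans (rnorm_le_part _))// (splitr e) lerD//.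
  exact: le_trans (norm_part_mkscalar true a b _) (uNa _ an).
exact: le_trans (norm_part_mkscalar false a b _) (uNb _ bn).
Qed.

(** Closed balls are closed. *)
Lemma cvg_rnorm_le (Y : normedModType K) (y : nat -> Y) (z w : Y) (M : R) :
  y @ \oo --> z -> (\forall n \near \oo, rnorm (w - y n) <= M) ->
  rnorm (w - z) <= M.
Proof.
move=> /rcvgP yz wM; apply/ler_addgt0Pr => e /yz ye.
near \oo => n; apply: le_trans (rnorm_triangle w (y n) z) _.
by apply: lerD; [near: n|rewrite rnorm_distC; near: n].
Unshelve. all: by end_near.
Qed.

Lemma rcvg_unique (Y : normedModType K) (y : nat -> Y) (z w : Y) :
  y @ \oo --> z -> y @ \oo --> w -> z = w.
Proof. by move=> yz yw; exact: (cvg_unique (@norm_hausdorff _ Y) yz yw). Qed.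

Variable X : normedModType K.

(** The pointwise limit exists since the scalars are complete; it is bounded
    because the convergence is uniform on the unit ball, and for the same reason it
    is a limit in norm. *)
Lemma dual_complete (y : nat -> dual X) : cauchy_sequence y ->
  exists z : dual X, y @ \oo --> z.
Proof.
move=> yC.
have /choice[phi phiE] : forall x, exists l : K^o, (fun n => y n x) @ \oo --> l.
  move=> x; apply: scalar_complete => e e0.
  have x1 : 0 < rnorm x + 1 by rewrite ltr_wpDl ?rnorm_ge0.
  have [N yN] := yC _ (divr_gt0 e0 x1).
  exists N => m n Nm Nn; rewrite -dualB.
  rewrite (le_trans (rnorm_dual_apply _ _))//.
  apply: (@le_trans _ _ (e / (rnorm x + 1) * (rnorm x + 1))).
    by apply: ler_pM => //; rewrite ?rnorm_ge0 ?yN// lerDl.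
  by rewrite divfK// gt_eqF.
have phil : linear phi.
  move=> a x x'; apply: (rcvg_unique (phiE _)).
  rewrite (_ : (fun n => _) = (fun n => a *: y n x + y n x')); last first.
    by apply/funext => n; rewrite linearP.
  by apply: cvgD; [apply: cvgZr|].
have phid e : 0 < e -> exists N, forall n x, (N <= n)%N ->
    rnorm (phi x - y n x) <= e * rnorm x.
  move=> /yC[N yN]; exists N => n x Nn.
  rewrite rnorm_distC; apply: (cvg_rnorm_le (phiE x)).
  exists N => // m /= Nm; rewrite -dualB (le_trans (rnorm_dual_apply _ _))//.
  by rewrite ler_wpM2r ?rnorm_ge0// yN.
have phic : continuous phi.
  have [N phiN] := phid 1 ltr01.
  pose M := 1 + rnorm (y N).
  have M0 : 0 < M by rewrite ltr_pwDl// rnorm_ge0.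
  have phiM x : rnorm (phi x) <= M * rnorm x.
    rewrite -[phi x](subrK (y N x)) (le_trans (rnormD _ _))// mulrDl.
    by apply: lerD; [exact: phiN|exact: rnorm_dual_apply].
  move=> x; apply/rcvgP => e e0.
  have /rcvgP := @cvg_id _ (nbhs x) => /(_ _ (divr_gt0 e0 M0)).
  apply: filterS => x' xx'; have -> : phi x - phi x' = phi (x - x').
    have := phil (-1) x' x; rewrite !scaleN1r [- x' + x]addrC => ->.
    by rewrite addrC.
  by rewrite (le_trans (phiM _))// -ler_pdivlMl// mulrC.
have phiP : phi \in @is_functional R s X by apply/asboolP; split.
exists (exist _ phi phiP : dual X).
apply/rcvgP => e e0; have [N phiN] := phid e e0; exists N => // n /= Nn.
apply: rnorm_dual_le => x x1; rewrite dualB.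
apply: le_trans (phiN n x Nn) _.
by rewrite -[leRHS]mulr1 ler_wpM2l// ltW.
Qed.

End Completeness.

Section Rosenthal.
Context {R : realType}.

(** Partition the indices into infinitely many infinite blocks.  If no block
    works, each block p has a row g p whose entries within its own block already sum
    to more than e.  The rows g p form a new index set which meets each block once,
    so on it every row sum has dropped by e, and induction on k applies.  An injective
    reindexing suffices, whence blocks are encoded with [pickle]. *)
Lemma rosenthal_step (k : nat) (e : R) (a : nat -> nat -> R) : 0 <= e ->
    (forall n m, 0 <= a n m) ->
    (forall n S, uniq S -> n \notin S -> \sum_(m <- S) a n m <= k%:R * e) ->
  exists2 f : nat -> nat, injective f &
    forall n S, uniq S -> n \notin S -> \sum_(m <- S) a (f n) (f m) <= e.
Proof.
move=> e0; elim: k a => [|k IH] a a0 aS.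
  exists id => // n S uS nS; apply: le_trans (aS n S uS nS) _.
  by rewrite mul0r.
pose block p j := pickle (p : nat, j : nat).
have blockI : forall p q i j, block p i = block q j -> p = q /\ i = j.
  by move=> p q i j /(pcan_inj pickleK)[].
have [[p pe]|no] := pselect (exists p, forall n S, uniq S -> n \notin S ->
    \sum_(m <- S) a (block p n) (block p m) <= e).
  by exists (block p) => // i j /blockI[].
have : forall p, exists nS : nat * seq nat, [/\ uniq nS.2, nS.1 \notin nS.2
    & e < \sum_(m <- nS.2) a (block p nS.1) (block p m)].
  move=> p; apply: contrapT => np; apply: no; exists p => n S uS nS.
  by rewrite leNgt; apply/negP => lt; apply: np; exists (n, S).
move=> /choice[N NP]; pose g p := block p (N p).1.
have gI : injective g by move=> p q /blockI[].
have [||f fI fe] := IH (fun n m => a (g n) (g m)).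
- by move=> n m; exact: a0.
- move=> p T uT pT; have [uS nS lt] := NP p.
  have := aS (g p) ([seq g q | q <- T] ++ [seq block p m | m <- (N p).2]).
  rewrite big_cat !big_map /= -natr1 mulrDl mul1r => H.
  suff /H sum_le : uniq ([seq g q | q <- T] ++ [seq block p m | m <- (N p).2]).
    rewrite -(lerD2r e); apply: le_trans (sum_le _).
      by rewrite lerD2l; exact: ltW.
    rewrite mem_cat negb_or; apply/andP.
    split; apply/mapP => -[q qT /blockI[pq mE]].
      by move: pT; rewrite pq qT.
    by move: nS; rewrite mE qT.
  rewrite cat_uniq !map_inj_uniq//; last by move=> i j /blockI[].
  rewrite uT uS andbT /=; apply/hasPn => _ /mapP[m mS ->].
  apply/mapP => -[q qT /blockI[pq mE]].
  by move: pT; rewrite pq qT.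
- by exists (g \o f) => //; exact: inj_comp.
Qed.

(** Rosenthal's lemma, which serves below to extract almost biorthogonal
    subsequences; iterating [rosenthal_step] C / e times suffices. *)
Lemma rosenthal (C e : R) (a : nat -> nat -> R) : 0 < e ->
    (forall n m, 0 <= a n m) ->
    (forall n S, uniq S -> \sum_(m <- S) a n m <= C) ->
  exists2 f : nat -> nat, injective f &
    forall n S, uniq S -> n \notin S -> \sum_(m <- S) a (f n) (f m) <= e.
Proof.
move=> e0 a0 aC; have [k Ck] : exists k : nat, C <= k%:R * e.
  exists (Num.truncn (C / e)).+1; rewrite -ler_pdivrMr//.
  exact/ltW/truncnS_gt.
apply: (@rosenthal_step k) => //; first exact: ltW.
by move=> n S uS _; apply: le_trans (aC n S uS) Ck.
Qed.

End Rosenthal.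

(** * The space c0 and its embeddings *)

Section C0Norm.
Context {R : realType} {s : scalar_kind}.
Notation K := (scalarField R s).
Implicit Types u v : nat -> K^o.

Lemma c0P u : c0 u <->
  forall e : R, 0 < e -> exists N, forall n, (N <= n)%N -> rnorm (u n) <= e.
Proof.
split=> [/rcvgP uc e /uc[N _ uN]|uN].
  by exists N => n Nn; have := uN n Nn; rewrite sub0r rnormN.
apply/rcvgP => e /uN[N {}uN]; exists N => // n /= Nn.
by rewrite sub0r rnormN; exact: uN.
Qed.

Lemma c0_lin (a : K) u v : c0 u -> c0 v -> c0 (a *: u + v).
Proof.
move=> cu cv; have : (fun n => a *: u n + v n) @ \oo --> a *: (0 : K^o) + 0.
  by apply: cvgD => //; apply: cvgZr.
by rewrite scaler0 addr0.
Qed.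

Lemma c0_norm_le u (M : R) : (forall n, rnorm (u n) <= M) -> c0_norm u <= M.
Proof.
move=> uM; apply: ge_sup; first by exists (rnorm (u 0%N)), 0%N.
by move=> _ [n _ <-].
Qed.

Lemma c0_norm_ub u n : c0 u -> rnorm (u n) <= c0_norm u.
Proof.
move=> /c0P/(_ 1 ltr01)[N uN]; apply: sup_ubound; last by exists n.
exists (1 + \sum_(i < N) rnorm (u i)) => _ [m _ <-].
have S0 (P : pred 'I_N) : 0 <= \sum_(i < N | P i) rnorm (u i).
  by apply: sumr_ge0 => i _; exact: rnorm_ge0.
have [Nm|mN] := leqP N m; first by rewrite (le_trans (uN m Nm))// lerDl S0.
by rewrite (bigD1 (Ordinal mN))//= addrCA lerDl addr_ge0.
Qed.

Lemma c0_norm_ge0 u : c0 u -> 0 <= c0_norm u.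
Proof. by move=> cu; rewrite (le_trans _ (c0_norm_ub 0 cu))// rnorm_ge0. Qed.

End C0Norm.

Section ClosedRange.
Context {R : realType} {s : scalar_kind}.
Notation K := (scalarField R s).
Variable Y : normedModType K.

(** Since T is bounded below, preimages of a convergent sequence are Cauchy in
    the sup norm; their limit is again in c0 and T maps it to the limit point. *)
Lemma bounded_below_closed (T : (nat -> K^o) -> Y) (M m : R) :
    (forall (a : K) u v, c0 u -> c0 v -> T (a *: u + v) = a *: T u + T v) ->
    (forall u, c0 u -> rnorm (T u) <= M * c0_norm u) ->
    0 < m -> (forall u, c0 u -> m * c0_norm u <= rnorm (T u)) ->
  closed (T @` (@c0 R s)).
Proof.
move=> linT TM m0 Tm y yT.
have /choice[v vP] : forall k : nat, exists u, c0 u /\ rnorm (y - T u) <= k.+1%:R^-1.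
  move=> k; have k0 : 0 < k.+1%:R^-1 :> R by rewrite invr_gt0.
  have /rcvgP/(_ _ k0) := @cvg_id _ (nbhs y).
  by move=> /yT[_ [[u cu <-] yu]]; exists u.
have TB u w : c0 u -> c0 w -> T (u - w) = T u - T w.
  move=> cu cw; have := linT (-1) w u cw cu.
  by rewrite !scaleN1r addrC => ->; rewrite addrC.
have cB (u w : nat -> K^o) : c0 u -> c0 w -> c0 (u - w).
  by move=> cu cw; rewrite addrC -scaleN1r; exact: c0_lin.
have dist k l n : rnorm (v k n - v l n) <= m^-1 * (k.+1%:R^-1 + l.+1%:R^-1).
  have [ck yk] := vP k; have [cl yl] := vP l.
  rewrite ler_pdivlMl//; apply: (@le_trans _ _ (m * c0_norm (v k - v l))).
    by rewrite ler_pM2l//; exact: (c0_norm_ub n (cB _ _ ck cl)).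
  rewrite (le_trans (Tm _ (cB _ _ ck cl)))// TB//.
  by rewrite (le_trans (rnorm_triangle _ y _))// lerD// rnorm_distC.
have small e : 0 < e -> exists N, forall k, (N <= k)%N -> k.+1%:R^-1 <= e :> R.
  move=> e0; have [N _ Ne] := near_infty_natSinv_lt (PosNum e0).
  by exists N => k /Ne/ltW.
have /choice[u uP] : forall n, exists l : K^o, (fun k => v k n) @ \oo --> l.
  move=> n; apply: scalar_complete => e e0.
  have [|N Ne] := small (m * e / 2); first by rewrite divr_gt0// mulr_gt0.
  exists N => k l Nk Nl; rewrite (le_trans (dist k l n))// ler_pdivrMl//.
  by rewrite (splitr (m * e)) lerD// Ne.
have uv k n : rnorm (u n - v k n) <= m^-1 * (k.+1%:R^-1 + k.+1%:R^-1).
  rewrite rnorm_distC; apply: (cvg_rnorm_le (uP n)); exists k => // l /= kl.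
  rewrite (le_trans (dist k l n))// ler_pM2l ?invr_gt0// lerD2l.
  by rewrite lef_pV2 ?posrE// ler_nat.
have smallm e : 0 < e ->
    exists N, forall k, (N <= k)%N -> m^-1 * (k.+1%:R^-1 + k.+1%:R^-1) <= e :> R.
  move=> e0; have [|N Ne] := small (m * e / 2); first by rewrite divr_gt0// mulr_gt0.
  by exists N => k Nk; rewrite ler_pdivrMl// (splitr (m * e)) lerD// Ne.
have cu : c0 u.
  apply/c0P => e e0; have e2 : 0 < e / 2 by rewrite divr_gt0.
  have [k kP] := smallm _ e2; have [/c0P/(_ _ e2)[N vN] _] := vP k.
  exists N => n Nn; rewrite -[u n](subrK (v k n)) (le_trans (rnormD _ _))//.
  by rewrite (splitr e) lerD ?vN// (le_trans (uv k n))// kP.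
exists u => //; apply/eqP; rewrite -subr_eq0; apply/eqP/rnorm0_eq0/eqP.
rewrite eq_le rnorm_ge0 andbT; apply/ler_addgt0Pr => e e0; rewrite add0r.
have e2 : 0 < e / 2 by rewrite divr_gt0.
have M1 : 0 < `|M| + 1 by rewrite ltr_wpDl.
have [N1 N1P] := smallm (e / 2 / (`|M| + 1)) (divr_gt0 e2 M1).
have [N2 N2P] := small _ e2.
pose k := maxn N1 N2; have [ck yk] := vP k.
apply: le_trans (rnorm_triangle _ (T (v k)) _) _; rewrite (splitr e).
apply: lerD; last by rewrite rnorm_distC (le_trans yk)// N2P// leq_maxr.
rewrite -TB//; apply: le_trans (TM _ (cB _ _ cu ck)) _.
apply: (@le_trans _ _ ((`|M| + 1) * c0_norm (u - v k))).
  apply: ler_wpM2r; first exact: c0_norm_ge0 (cB _ _ cu ck).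
  by rewrite (le_trans (ler_norm M))// lerDl.
rewrite -ler_pdivlMl// mulrC; apply: c0_norm_le => n.
by rewrite (le_trans (uv k n))// N1P// leq_maxl.
Qed.

End ClosedRange.

Section BessagaPelczynski.
Context {R : realType} {s : scalar_kind}.
Notation K := (scalarField R s).
Variable X : normedModType K.

(** At a fixed x, grouping the terms by the sign of the real and of the imaginary
    part turns bounds on partial sums into absolute summability; each of the four
    groups contributes at most C |x|. *)
Lemma subsums_absolute (y : nat -> dual X) (C : R) :
    (forall S, uniq S -> rnorm (\sum_(n <- S) y n) <= C) ->
  forall x S, uniq S -> \sum_(n <- S) rnorm (y n x) <= 4 * C * rnorm x.
Proof.
move=> yC x S uS.
have partS c (P : seq nat) : uniq P -> `|\sum_(n <- P) part c (y n x)| <= C * rnorm x.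
  move=> uP; rewrite -part_sum -dual_sum; apply: le_trans (norm_part _ _) _.
  rewrite (le_trans (rnorm_dual_apply _ _))//.
  by rewrite ler_wpM2r ?rnorm_ge0// yC.
have absS c : \sum_(n <- S) `|part c (y n x)| <= 2 * (C * rnorm x).
  rewrite (bigID (fun n => 0 <= part c (y n x)))/= mulrDl mul1r; apply: lerD.
    rewrite (eq_bigr (fun n => part c (y n x))); last by move=> n /ger0_norm.
    rewrite -big_filter (le_trans (ler_norm _))//.
    by apply: partS; rewrite filter_uniq.
  rewrite (eq_bigr (fun n => - part c (y n x))); last first.
    by move=> n; rewrite -ltNge => /ltr0_norm.
  rewrite -big_filter sumrN (le_trans (ler_norm _))// normrN.
  by apply: partS; rewrite filter_uniq.
have := lerD (absS true) (absS false); rewrite -big_split/= => H.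
apply: le_trans (le_trans (ler_sum _ _) H) _; first by move=> n _; exact: rnorm_le_part.
by rewrite le_eqVlt; apply/orP; left; apply/eqP; ring.
Qed.

End BessagaPelczynski.

(** * Bounded subset sums and c0 *)

Section BessagaPelczynskiDual.
Context {R : realType} {s : scalar_kind}.
Notation K := (scalarField R s).
Variable X : normedModType K.

(** The dual-space case of the theorem of Bessaga and Pelczynski.  Choose x n in
    the unit ball almost norming y n.  The matrix of norms of y m (x n) has bounded
    row sums by [subsums_absolute], so [rosenthal] provides a subsequence z almost
    biorthogonal to the corresponding vectors.  The operator u |-> sum of the
    u n z n then embeds c0: evaluating its value at the n-th vector recovers u n up
    to a term at most delta / 4 times the sup norm of u. *)
Lemma bessaga_pelczynski (y : nat -> dual X) (C delta : R) : 0 < delta ->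
    (forall n, delta <= rnorm (y n)) ->
    (forall S, uniq S -> rnorm (\sum_(n <- S) y n) <= C) ->
  contains_c0 (dual X).
Proof.
move=> d0 yd yC; pose D := 4 * C.
have yD x S : uniq S -> \sum_(n <- S) rnorm (y n x) <= D * rnorm x.
  exact: subsums_absolute.
have D0 : 0 <= D.
  by rewrite mulr_ge0//; have := yC [::] isT; rewrite big_nil rnorm0.
have /choice[x xP] : forall n, exists x, rnorm x <= 1 /\ delta / 2 <= rnorm (y n x).
  move=> n; have [|x x1 xd] := @rnorm_dual_lt _ _ _ (y n) (delta / 2).
    by rewrite (lt_le_trans _ (yd n))// ltr_pdivrMr// ltr_pMr// ltr1n.
  by exists x; split=> //; exact: ltW.
have [|||f fI offdiag] := @rosenthal R D (delta / 4) (fun n m => rnorm (y m (x n))).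
- by rewrite divr_gt0.
- by move=> n m; exact: rnorm_ge0.
- move=> n S uS; rewrite (le_trans (yD _ _ uS))// ler_piMr//.
  by have [] := xP n.
pose z n := y (f n); pose xi n := x (f n).
have zD p q r : \sum_(p <= n < q) rnorm (z n r) <= D * rnorm r.
  rewrite -(big_map f xpredT (fun n => rnorm (y n r))); apply: yD.
  by rewrite map_inj_uniq// iota_uniq.
pose P (u : nat -> K^o) N : dual X := \sum_(0 <= n < N) u n *: z n.
(* For u in c0 the tails of the series are uniformly small: its partial sums are
   Cauchy in norm. *)
have Ptail (u : nat -> K^o) (e : R) p q : (forall n, (p <= n)%N -> rnorm (u n) <= e) ->
    rnorm (\sum_(p <= n < q) u n *: z n) <= e * D.
  move=> ue; have e0 : 0 <= e by rewrite (le_trans _ (ue p (leqnn p)))// rnorm_ge0.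
  apply: rnorm_dual_le => r r1; rewrite dual_sum (le_trans (rnorm_sum _ _))//.
  apply: (@le_trans _ _ (\sum_(p <= n < q) e * rnorm (z n r))).
    rewrite big_nat [leRHS]big_nat; apply: ler_sum => n /andP[pn _].
    by rewrite dualZ rnormZ ler_wpM2r ?rnorm_ge0// ue.
  rewrite -mulr_sumr ler_wpM2l// (le_trans (zD _ _ _))// ler_piMr//.
have PC u : c0 u -> cauchy_sequence (P u).
  move=> /c0P uc e e0.
  have [N uN] := uc (e / (D + 1)) (divr_gt0 e0 (ltr_wpDl D0 ltr01)).
  have tail p q : (N <= p)%N -> (p <= q)%N -> rnorm (P u q - P u p) <= e.
    move=> Np pq; rewrite /P (big_cat_nat (leq0n p) pq)/= addrAC subrr add0r.
    rewrite (le_trans (@Ptail u (e / (D + 1)) p q _))//.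
      by move=> n pn; exact: uN (leq_trans Np pn).
    by rewrite mulrAC ler_pdivrMr ?ltr_wpDl// ler_pM2l// lerDl.
  exists N => m n Nm Nn; have [mn|nm] := leqP m n.
    by rewrite rnorm_distC; exact: tail.
  by apply: tail => //; exact: ltnW.
pose T u : dual X := lim (P u @ \oo).
have TP u : c0 u -> P u @ \oo --> T u.
  by move=> /PC/dual_complete[t Pt]; rewrite /T (cvg_lim (@norm_hausdorff _ _) Pt).
have linT (a : K) u v : c0 u -> c0 v -> T (a *: u + v) = a *: T u + T v.
  move=> cu cv; apply: rcvg_unique (TP _ (c0_lin a cu cv)) _.
  rewrite (_ : P _ = fun N => a *: P u N + P v N).
    by apply: cvgD; [apply: cvgZr; exact: TP|exact: TP].
  apply/funext => N; rewrite /P scaler_sumr -big_split/=; apply: eq_bigr => n _.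
  by rewrite scalerDl scalerA.
have Tub u : c0 u -> rnorm (T u) <= D * c0_norm u.
  move=> cu; rewrite -[T u]subr0 rnorm_distC; apply: cvg_rnorm_le (TP u cu) _.
  apply: nearW => N; rewrite sub0r rnormN mulrC; apply: Ptail => n _.
  exact: c0_norm_ub.
have Tlb u : c0 u -> delta / 4 * c0_norm u <= rnorm (T u).
  move=> cu; have u0 := c0_norm_ge0 cu.
  have coord n : delta / 2 * rnorm (u n) <= rnorm (T u) + delta / 4 * c0_norm u.
    apply/ler_addgt0Pr => e e0.
    have [N TN] := rcvg_cauchy (TP u cu) e0.
    pose N' := maxn N n.+1; have {}TN : rnorm (T u - P u N') <= e.
      by apply: TN; exact: leq_maxl.
    have nN : (n < N')%N by exact: leq_maxr.
    have PE : P u N' (xi n) = u n * z n (xi n)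
        + \sum_(m <- rem n (index_iota 0 N')) u m * z m (xi n).
      rewrite /P dual_sum (big_rem n); last by rewrite mem_index_iota.
      by rewrite /= dualZ; congr (_ + _); apply: eq_bigr => m _; rewrite dualZ.
    have off : rnorm (\sum_(m <- rem n (index_iota 0 N')) u m * z m (xi n) : K^o)
        <= delta / 4 * c0_norm u.
      apply: le_trans (rnorm_sum _ _) _.
      apply: (@le_trans _ _ (\sum_(m <- rem n (index_iota 0 N'))
          c0_norm u * rnorm (z m (xi n)))).
        apply: ler_sum => m _; rewrite (rnormZ (u m) (z m (xi n))).
        by rewrite ler_wpM2r ?rnorm_ge0// c0_norm_ub.
      rewrite -mulr_sumr mulrC ler_wpM2r//; apply: offdiag.
        by rewrite rem_uniq// iota_uniq.
      by rewrite mem_rem_uniq ?iota_uniq// inE eqxx.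
    have PT : rnorm (P u N' (xi n)) <= rnorm (T u) + e.
      apply: le_trans (rnorm_dual_apply _ _) _.
      have Pn : rnorm (P u N') <= rnorm (T u) + e.
        rewrite -[P u N'](subrK (T u)) addrC (le_trans (rnormD _ _))//.
        by rewrite lerD2l rnorm_distC.
      by rewrite (le_trans _ Pn)// ler_piMr ?rnorm_ge0//; have [] := xP (f n).
    apply: (@le_trans _ _ (rnorm (u n * z n (xi n) : K^o))).
      rewrite (rnormZ (u n) (z n (xi n))) mulrC ler_wpM2l ?rnorm_ge0//.
      by have [] := xP (f n).
    have -> : u n * z n (xi n) = P u N' (xi n)
        - \sum_(m <- rem n (index_iota 0 N')) u m * z m (xi n).
      by rewrite PE addrK.
    rewrite (le_trans (rnormD _ _))// rnormN addrAC lerD//.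
  have d2 : 0 < delta / 2 by rewrite divr_gt0.
  have : c0_norm u <= (delta / 2)^-1 * (rnorm (T u) + delta / 4 * c0_norm u).
    by apply: c0_norm_le => n; rewrite ler_pdivlMl.
  by rewrite ler_pdivlMl// => H; lra.
exists T; split=> //.
- by exists D.
- by exists (delta / 4) => //; rewrite divr_gt0.
- apply: (bounded_below_closed linT Tub _ Tlb).
  by rewrite divr_gt0.
Qed.

End BessagaPelczynskiDual.

(** * Increments of primitives *)

Section PrimitiveIncrements.
Context {R : realType}.
Implicit Types (u f : R -> R) (t a b e l : R).

Lemma primitive_expansion u t : continuous u -> forall e, 0 < e ->
  exists2 d, 0 < d & forall k, `|k| < d ->
    `|primitive u (t + k) - primitive u t - u t * k| <= e * `|k|.
Proof.
move=> cu e e0; have := cu t; move/cvgrPdist_le => /(_ e e0).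
move=> /nbhs_ballP[d /= d0 ud]; exists d => // k kd.
have iu := continuous_loc_integrable cu.
have step a b : a <= b -> (forall r, a < r <= b -> `|u r - u t| <= e) ->
    `|primitive u b - primitive u a - u t * (b - a)| <= e * (b - a).
  move=> ab uab; rewrite primitiveB//.
  have ic : loc_integrable (cst (u t)).
    by apply: continuous_loc_integrable; exact: cst_continuous.
  have -> : u t * (b - a) = \int[leb R]_(r in `]a, b]) u t.
    by rewrite Rintegral_cst ?leb_oc//; exact: leb_itv.
  rewrite -RintegralB; last 3 first.
    exact: leb_itv.
    exact: loc_integrable_oc.
    exact: loc_integrable_oc.
  apply: norm_Rintegral_oc_le; [|exact: ab|exact: uab].
  apply: continuous_loc_integrable => r; apply: cvgB; first exact: cu.
  exact: cvg_cst.
have near_t r : `|r - t| <= `|k| -> `|u r - u t| <= e.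
  by move=> rt; rewrite distrC; apply: ud; rewrite /ball/= distrC (le_lt_trans rt).
have [k0|/ltW k0] := leP 0 k.
  have kE : t + k - t = k by ring.
  have := step t (t + k); rewrite lerDl kE (ger0_norm k0).
  apply=> // r /andP[tr rt]; apply: near_t.
  by rewrite (ger0_norm k0) ler_norml; apply/andP; split; lra.
have kE : t - (t + k) = - k by ring.
have := step (t + k) t; rewrite gerDl kE (ler0_norm k0) => H.
rewrite -normrN; set z := - _.
have -> : z = primitive u t - primitive u (t + k) - u t * - k by rewrite /z; ring.
apply: (H k0) => r /andP[tr rt]; apply: near_t.
by rewrite (ler0_norm k0) ler_norml; apply/andP; split; lra.
Qed.

Lemma is_derive_expansion f a l :
    (forall e, 0 < e -> exists2 d, 0 < d & forall k, `|k| < d ->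
      `|f (a + k) - f a - l * k| <= e * `|k|) ->
  is_derive a 1 f l.
Proof.
move=> fl; have fP : h^-1 *: (f (h *: (1 : R) + a) - f a) @[h --> (0 : R)^'] --> l.
  apply/cvgrPdist_le => e /fl[d d0 fd]; near=> k.
  have k0 : k != 0 by near: k; exact: nbhs_dnbhs_neq.
  have kd : `|k| < d by near: k; exact: dnbhs0_lt.
  have kn : 0 < `|k| by rewrite normr_gt0.
  have -> : l - k^-1 *: (f (k *: (1 : R) + a) - f a)
      = - (f (a + k) - f a - l * k) / k.
    by rewrite [k *: 1]mulr1 [k + a]addrC /GRing.scale/=; field.
  rewrite normrM normrN normfV ler_pdivrMr//; exact: fd.
split; first by apply/cvg_ex; exists l.
exact/cvg_lim.
Unshelve. all: by end_near.
Qed.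

(** Mean value inequality for the difference of two translates of the primitive,
    whose derivative is at most e in absolute value. *)
Lemma primitive_shift_increment u tau e a b : continuous u ->
    (forall r, `|u (r + tau) - u r| <= e) -> a <= b ->
  `|primitive u (b + tau) - primitive u b
    - (primitive u (a + tau) - primitive u a)| <= e * (b - a).
Proof.
move=> cu ue ab; pose G t := primitive u (t + tau) - primitive u t.
have dG t : is_derive t 1 G (u (t + tau) - u t).
  apply: is_derive_expansion => d d0; have d2 : 0 < d / 2 by rewrite divr_gt0.
  have [d1 d10 P1] := primitive_expansion (t + tau) cu d2.
  have [d3 d30 P3] := primitive_expansion t cu d2.
  exists (Num.min d1 d3) => [|k]; rewrite lt_min ?d10// => /andP[/P1 k1 /P3 k3].
  have := le_trans (ler_normB _ _) (lerD k1 k3); rewrite -mulrDl -splitr.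
  apply: le_trans; rewrite le_eqVlt; apply/orP; left; apply/eqP.
  by congr `|_|; rewrite /G [t + k + tau]addrAC; lra.
have [|c _] := @MVT_segment _ G (fun t => u (t + tau) - u t) a b ab (fun t _ => dG t).
- apply: continuous_subspaceT => t; apply: differentiable_continuous.
  by apply/derivable1_diffP; case: (dG t).
- rewrite /G => ->; rewrite normrM (ger0_norm (x := b - a)) ?subr_ge0//.
  by rewrite ler_wpM2r ?subr_ge0.
Qed.

End PrimitiveIncrements.

(** * Kadets' theorem *)

Section Kadets.
Context {R : realType} {s : scalar_kind}.
Notation K := (scalarField R s).
Variable X : normedModType K.
(* H is the weak* primitive of h, stated on real and imaginary parts. *)
Variables h H : R -> dual X.
Hypothesis h_cont : continuous h.
Hypothesis H_primitive : forall c t (x : X),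
  part c (H t x) = primitive (fun r => part c (h r x)) t.

Definition almost_period (e : R) (tau : R) :=
  forall r, rnorm (h (r + tau) - h r) <= e.

Lemma almost_periodD d e sigma tau : almost_period d sigma ->
  almost_period e tau -> almost_period (d + e) (sigma + tau).
Proof.
move=> ds et r; apply: le_trans (rnorm_triangle _ (h (r + sigma)) _) _.
by rewrite addrC lerD// addrA.
Qed.

Lemma rnorm_dual_parts (y : dual X) (M : R) : 0 <= M ->
  (forall c x, `|part c (y x)| <= M * rnorm x) -> rnorm y <= 2 * M.
Proof.
move=> M0 yM; apply: rnorm_dual_le => x x1; apply: le_trans (rnorm_le_part _) _.
apply: le_trans (lerD (yM true x) (yM false x)) _.
have Mx : M * rnorm x <= M by rewrite ler_piMr.
by rewrite mulrDl mul1r lerD.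
Qed.

(** The increment of H over [a, b] is the integral of h, so shifting the interval
    by an almost period changes it by at most e |b - a|; the factor 2 comes from
    treating the real and imaginary parts separately. *)
Lemma weak_primitive_shift e tau a b : 0 <= e -> almost_period e tau ->
  rnorm (H (b + tau) - H b - (H (a + tau) - H a)) <= 2 * (e * `|b - a|).
Proof.
move=> e0 et; wlog ab : a b / a <= b.
  move=> W; have [ab|/ltW ba] := leP a b; first exact: W.
  by rewrite rnorm_distC distrC; exact: W.
apply: rnorm_dual_parts; first exact: mulr_ge0.
move=> c x; rewrite !dualB !partB !H_primitive.
have cu := continuous_part_apply (c := c) (x := x) h_cont.
have ue r : `|part c (h (r + tau) x) - part c (h r x)| <= e * rnorm x.
  rewrite -partB -dualB (le_trans (norm_part_apply _ _ _))//.
  by rewrite ler_wpM2r ?rnorm_ge0//; exact: et.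
apply: le_trans (primitive_shift_increment cu ue ab) _.
by rewrite mulrAC ger0_norm ?subr_ge0.
Qed.

Lemma continuous_weak_primitive : continuous H.
Proof.
move=> t; apply/rcvgP => e e0.
have /rcvgP/(_ 1 ltr01)/nbhs_ballP[d /= d0 hd] := @h_cont t.
pose M := rnorm (h t) + 1.
have M0 : 0 < M by rewrite ltr_wpDl ?rnorm_ge0.
have hM r : `|r - t| < d -> rnorm (h r) <= M.
  move=> rt; rewrite -[h r](subrK (h t)) (le_trans (rnormD _ _))// addrC.
  by rewrite lerD2l rnorm_distC; apply: hd; rewrite /ball/= distrC.
have lip a b : a <= b -> (forall r, a < r <= b -> `|r - t| < d) ->
    rnorm (H b - H a) <= 2 * (M * (b - a)).
  move=> ab abd; apply: rnorm_dual_parts => [|c x].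
    by rewrite mulr_ge0 ?subr_ge0// ltW.
  rewrite dualB partB !H_primitive.
  have iu := continuous_loc_integrable (continuous_part_apply (c := c) (x := x) h_cont).
  rewrite primitiveB// mulrAC; apply: norm_Rintegral_oc_le => // r /abd/hM hr.
  by rewrite (le_trans (norm_part_apply _ _ _))// ler_wpM2r ?rnorm_ge0.
apply/nbhs_ballP; exists (Num.min d (e / (2 * M))) => /=.
  by rewrite lt_min d0/= divr_gt0// mulr_gt0.
move=> r; rewrite /ball/= lt_min ltr_pdivlMr ?mulr_gt0// => /andP[rd re].
have {re} small : 2 * (M * `|t - r|) <= e by rewrite mulrA mulrC ltW.
have [tr|/ltW rt] := leP t r.
  rewrite rnorm_distC; apply: le_trans (lip _ _ tr _) _.
    move=> q /andP[tq qr]; apply: le_lt_trans rd; rewrite ler_norml.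
    by have := ler_norm (r - t); rewrite distrC => ?; apply/andP; split; lra.
  by rewrite -(ger0_norm (x := r - t)) ?subr_ge0// distrC.
apply: le_trans (lip _ _ rt _) _.
  move=> q /andP[rq qt]; apply: le_lt_trans rd; rewrite ler_norml.
  by have := ler_norm (t - r) => ?; apply/andP; split; lra.
by rewrite -(ger0_norm (x := t - r)) ?subr_ge0.
Qed.

Variable M : R.
Hypothesis H_bounded : forall t, rnorm (H t) <= M.
Hypothesis no_c0 : ~ contains_c0 (dual X).

(** Otherwise there are almost periods tau n of h, with accuracies as good as
    desired, at which H - H 0 has norm at least delta.  Choose them one after the
    other, the accuracy of tau n being so good compared with the sum of the previous
    ones that shifting by tau n increases H by almost H (tau n) - H 0 at every earlier
    finite sum.  Finite sums of the vectors H (tau n) - H 0 are then close to values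
    of H - H 0, hence bounded, and [bessaga_pelczynski] embeds c0 in the dual. *)
Lemma almost_period_increment delta : 0 < delta ->
  exists2 e, 0 < e & forall tau, almost_period e tau -> rnorm (H tau - H 0) <= delta.
Proof.
move=> d0; apply: contrapT => no_e; apply: no_c0.
have /choice[sel selP] : forall e, exists tau,
    0 < e -> almost_period e tau /\ delta <= rnorm (H tau - H 0).
  move=> e; have [e0|e0] := ltP 0 e; last by exists 0.
  apply: contrapT => no_tau; apply: no_e; exists e => // tau etau.
  rewrite leNgt; apply/negP => dtau; apply: no_tau; exists tau => _.
  by split=> //; exact: ltW.
(* A n bounds every sum of distinct terms among the first n almost periods; the
   accuracy of the next one is chosen against it. *)
pose fix A n : R := if n is n'.+1
  then A n' + `|sel (2 ^- n' / (1 + A n'))| else 0.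
pose e n := 2 ^- n / (1 + A n).
pose tau n := sel (e n).
have A0 n : 0 <= A n by elim: n => //= n IH; rewrite addr_ge0.
have A1 n : 0 < 1 + A n by rewrite ltr_pwDl.
have e0 n : 0 < e n by rewrite divr_gt0// invr_gt0 exprn_gt0.
(* The accumulated error 2 * (1 + 1/2 + ... + 2^-(n-1)) equals 4 - 4 * 2^-n. *)
have partial (p : pred nat) n :
    `|\sum_(j < n | p j) tau j| <= A n /\
    rnorm (H (\sum_(j < n | p j) tau j) - H 0
           - \sum_(j < n | p j) (H (tau j) - H 0)) <= 4 - 4 * 2 ^- n.
  elim: n => [|n [IHA IHn]].
    by rewrite !big_ord0 normr0 !subrr rnorm0 expr0 invr1 mulr1 subrr.
  rewrite !(big_mkcond (fun j : 'I__ => p j)) !big_ord_recr/=.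
  rewrite -!(big_mkcond (fun j : 'I__ => p j)).
  set S := \sum_(j < n | p j) tau j in IHA IHn *.
  set Y := \sum_(j < n | p j) (H (tau j) - H 0) in IHn *.
  have p2 : 2 ^- n.+1 = 2 ^- n / 2 :> R by rewrite exprS invfM mulrC.
  have p0 : 0 < 2 ^- n :> R by rewrite invr_gt0 exprn_gt0.
  case: (p n); last first.
    rewrite !addr0; split; first by rewrite (le_trans IHA)// lerDl.
    by apply: le_trans IHn _; rewrite p2; lra.
  split; first by apply: le_trans (ler_normD _ _) _; rewrite lerD.
  have [etau _] := selP _ (e0 n).
  have := weak_primitive_shift 0 S (ltW (e0 n)) etau.
  rewrite -/(tau n) add0r subr0 => shift.
  have small : e n * `|S| <= 2 ^- n.
    rewrite /e mulrAC ler_pdivrMr// ler_pM2l//.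
    by rewrite (le_trans IHA)// lerDr.
  have -> : H (S + tau n) - H 0 - (Y + (H (tau n) - H 0)) =
      (H S - H 0 - Y) + (H (S + tau n) - H S - (H (tau n) - H 0)).
    rewrite opprD [LHS]addrA [RHS]addrA; congr (_ + _).
    by rewrite [RHS]addrC -[H S - H 0 - Y]addrA [RHS]addrA subrK addrA.
  apply: le_trans (rnormD _ _) _.
  by rewrite p2; move: IHn shift small; lra.
apply: (@bessaga_pelczynski _ _ X (fun n => H (tau n) - H 0) (4 + (M + M)) delta) => //.
  by move=> n; have [] := selP _ (e0 n).
move=> S uS; pose n := (\max_(j <- S) j).+1.
have -> : \sum_(j <- S) (H (tau j) - H 0)
    = \sum_(j < n | (j : nat) \in S) (H (tau j) - H 0).
  rewrite -(big_mkord (fun j => j \in S) (fun j => H (tau j) - H 0)) -big_filter.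
  apply: perm_big; apply: uniq_perm => //; first by rewrite filter_uniq// iota_uniq.
  move=> j; rewrite mem_filter mem_index_iota /=.
  have [jS|//] := boolP (j \in S).
  by rewrite /= ltnS; apply/esym; exact: leq_bigmax_seq.
have [_ Sn] := partial (fun j => j \in S) n.
set T := \sum_(j < n | _) tau j in Sn; set Y := \sum_(j < n | _) _ in Sn *.
have p0 : 0 < 2 ^- n :> R by rewrite invr_gt0 exprn_gt0.
have -> : Y = (H T - H 0) - (H T - H 0 - Y) by rewrite opprB addrC subrK.
apply: le_trans (rnormD _ _) _; rewrite rnormN addrC lerD//.
  by apply: le_trans Sn _; lra.
by apply: le_trans (rnormD _ _) _; rewrite rnormN lerD.
Qed.

(** Kadets' theorem, with explicit control of the almost periods, so that it can
    be combined with the almost periodicity of h itself.  Given r, pick an almost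
    period p of h with r - p in [0, L].  By [weak_primitive_shift] the increment
    of H from r to r + tau is close to the one from p to p + tau, and the latter is
    small because H - H 0 is small at p and at p + tau by [almost_period_increment]. *)
Lemma kadets delta : almost_periodic h -> 0 < delta ->
  exists2 e, 0 < e &
    forall tau, almost_period e tau -> forall r, rnorm (H (r + tau) - H r) <= delta.
Proof.
move=> [_ hAP] d0; have d4 : 0 < delta / 4 by rewrite divr_gt0.
have [e1 e10 small] := almost_period_increment d4.
have e12 : 0 < e1 / 2 by rewrite divr_gt0.
have [L L0 hL] := hAP _ e12.
have L1 : 0 < 4 * L by rewrite mulr_gt0.
pose e := Num.min (e1 / 2) (delta / (4 * L)).
have e0 : 0 < e by rewrite lt_min e12 divr_gt0.
have ele : e <= e1 / 2 by rewrite ge_min lexx.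
have eL : e * L <= delta / 4.
  have : e <= delta / (4 * L) by rewrite ge_min lexx orbT.
  by rewrite ler_pdivlMr//; lra.
exists e => // tau etau r.
have [p /andP[pl pr] eP] := hL (r - L).
have eP1 : almost_period e1 p.
  by move=> q; rewrite (le_trans (eP q))// ler_pdivrMr// ler_pMr// ler1n.
have ePt : almost_period e1 (p + tau).
  move=> q; apply: le_trans (almost_periodD eP etau q) _.
  by rewrite [leRHS]splitr lerD2l.
have sp := small _ eP1; have spt := small _ ePt.
have shift := weak_primitive_shift p r (ltW e0) etau.
have rp : `|r - p| <= L.
  by rewrite subrK in pr; rewrite ger0_norm ?subr_ge0// lerBlDl -lerBlDr.
have eRP : e * `|r - p| <= delta / 4 by rewrite (le_trans _ eL)// ler_pM2l.
have pE : H (p + tau) - H p = (H (p + tau) - H 0) - (H p - H 0).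
  by rewrite [RHS]addrC opprB addrC addrA subrK.
have -> : H (r + tau) - H r = (H (r + tau) - H r - (H (p + tau) - H p))
    + ((H (p + tau) - H 0) - (H p - H 0)).
  by rewrite -pE subrK.
have half : delta / 2 = 2 * (delta / 4) by field.
apply: le_trans (rnormD _ _) _; rewrite [leRHS]splitr; apply: lerD.
  by apply: le_trans shift _; rewrite half ler_pM2l.
have -> : delta / 2 = delta / 4 + delta / 4 by field.
by apply: le_trans (rnormD _ _) _; rewrite rnormN; exact: lerD spt sp.
Qed.

End Kadets.

(** * Integrating the resolvent *)

Theorem theorem3p4 (R : realType) (s : scalar_kind)
    (X : completeNormedModType (scalarField R s))
    (no_c0 : ~ contains_c0 (dual X))
    (f : R -> dual X) (f_Linf : Linf_wstar f)
    (Rf : R -> R -> dual X)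
    (Rf_resolvent : forall lambda : R, 0 < lambda ->
       is_adjoint_resolvent lambda f (Rf lambda))
    (Rf_AP : forall lambda : R, 0 < lambda -> almost_periodic (Rf lambda))
    (Rf_bounded : forall lambda : R, 0 < lambda ->
       exists M : R, forall t : R,
         exists2 I, is_bochner_primitive_at (Rf lambda) t I & rnorm I <= M) :
  exists2 F : R -> dual X, is_wstar_primitive f F & almost_periodic F.
Proof.
pose h := Rf 1; have hAP : almost_periodic h := Rf_AP 1 ltr01.
have hc : continuous h := hAP.1.
have [M HM] := Rf_bounded 1 ltr01.
have /choice[H HP] : forall t, exists I : dual X,
    is_bochner_primitive_at h t I /\ rnorm I <= M.
  by move=> t; have [I hI IM] := HM t; exists I.
have Hprim c t (x : X) :
    part c (dual_fun (H t) x) = primitive (fun r => part c (h r x)) t.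
  by apply: bochner_primitive_part => //; have [] := HP t.
exists (fun t => H t - h t + h 0).
  move=> t x; apply: part_eq => c.
  rewrite (resolvent_primitive c x t f_Linf hc (Rf_resolvent 1 ltr01)) -/h -Hprim.
  by rewrite dualD dualB partD partB opprB addrA addrAC.
split=> [|eps e0].
  move=> t; apply: cvgD; last exact: cvg_cst.
  by apply: cvgB; [exact: (continuous_weak_primitive hc Hprim)|exact: hc].
have e2 : 0 < eps / 2 by rewrite divr_gt0.
have [e e_gt0 He] := kadets hc Hprim (fun t => (HP t).2) no_c0 hAP e2.
have [|L L0 hL] := hAP.2 (Num.min e (eps / 2)).
  by rewrite lt_min e_gt0.
exists L => // a; have [tau atau hP] := hL a; exists tau => // r.
have he : almost_period h e tau by move=> q; rewrite (le_trans (hP q))// ge_min lexx.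
have hr : rnorm (h (r + tau) - h r) <= eps / 2.
  by rewrite (le_trans (hP r))// ge_min lexx orbT.
have -> : H (r + tau) - h (r + tau) + h 0 - (H r - h r + h 0)
    = (H (r + tau) - H r) - (h (r + tau) - h r).
  rewrite opprD addrACA subrr addr0 !opprB addrACA [RHS]addrACA.
  by congr (_ + _); exact: addrC.
rewrite (le_trans (rnormD _ _))// rnormN (splitr eps) lerD//.
exact: He.
Qed.
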